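(* Let $K$ be an infinite countable compact metric space. Then the $3$-fold projective tensor product $C(K) \widehat{\otimes}_\pi C(K)\widehat{\otimes}_\pi C(K)$ is not isomorphic to any quotient of the $2$-fold projective tensor product $C(K) \widehat{\otimes}_\pi C(K)$.
   Context: $C(K)$ is the Banach space of all continuous real-valued functions on $K$ with the supremum norm; Banach spaces are over the real scalars. For a Banach space $X$ and $n\in\mathbb{N}$, the $n$-fold projective tensor product $X\widehat{\otimes}_\pi\cdots\widehat{\otimes}_\pi X$ is the completion of the algebraic tensor product of $n$ copies of $X$ under the norm $\|u\|_\pi=\inf\{\sum_{j=1}^m \|x^1_j\|\cdots\|x^n_j\| : m\in\mathbb{N},\ u=\sum_{j=1}^m x^1_j\otimes\cdots\otimes x^n_j\}$. ''Isomorphic'' means linearly homeomorphic (not necessarily isometric). A quotient of a Banach space $Y$ is a space $Y/Z$ with $Z$ a closed linear subspace of $Y$, with the quotient norm. *)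

(* Defs.v *)
From HB Require Import structures.
From mathcomp Require Import all_boot all_order all_algebra.
From mathcomp Require Import all_classical all_reals all_analysis.
From mathcomp Require Import ring.
(* The notations of monalg clash with those of MathComp-Analysis. *)
From mathcomp Require Import -(notations) monalg.

Set Implicit Arguments.
Unset Strict Implicit.
Unset Printing Implicit Defensive.

Import Order.TTheory GRing.Theory Num.Theory.
Import numFieldNormedType.Exports.
Local Open Scope classical_set_scope.
Local Open Scope ring_scope.

Section QuotientModule.
Variables (R : pzRingType) (V : lmodType R) (Z : submodClosed V).
Local Open Scope quotient_scope.

Lemma submod_memN x : (- x \in Z) = (x \in Z).
Proof.
have memN y : y \in Z -> - y \in Z by rewrite -scaleN1r; exact: rpredZ.
by apply/idP/idP => [/memN|/memN//]; rewrite opprK.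
Qed.

Definition coset_rel : rel V := fun x y => x - y \in Z.

Lemma coset_rel_refl : reflexive coset_rel.
Proof. by move=> x; rewrite /coset_rel subrr rpred0. Qed.

Lemma coset_rel_sym : symmetric coset_rel.
Proof. by move=> x y; rewrite /coset_rel -opprB submod_memN. Qed.

Lemma coset_rel_trans : transitive coset_rel.
Proof.
move=> y x z; rewrite /coset_rel => xy yz.
by have := rpredD xy yz; rewrite addrA subrK.
Qed.

Canonical coset_rel_equiv :=
  EquivRel coset_rel coset_rel_refl coset_rel_sym coset_rel_trans.

Definition quotmod : Type := {eq_quot coset_rel}.
HB.instance Definition _ := Choice.on quotmod.
HB.instance Definition _ := EqQuotient.on quotmod.

Definition quotmod_pi (x : V) : quotmod := \pi_quotmod x.

Lemma quotmod_piP x y : quotmod_pi x = quotmod_pi y <-> x - y \in Z.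
Proof. by split => [/eqmodP|h]; [|apply/eqmodP]. Qed.

Lemma quotmod_reprK (q : quotmod) : quotmod_pi (repr q) = q.
Proof. exact: reprK. Qed.

Definition quotmod_add (p q : quotmod) := quotmod_pi (repr p + repr q).
Definition quotmod_opp (p : quotmod) := quotmod_pi (- repr p).
Definition quotmod_scale (a : R) (p : quotmod) := quotmod_pi (a *: repr p).

Lemma quotmod_repr x : repr (quotmod_pi x) - x \in Z.
Proof. by apply/quotmod_piP; rewrite quotmod_reprK. Qed.

Lemma quotmod_addE x y :
  quotmod_add (quotmod_pi x) (quotmod_pi y) = quotmod_pi (x + y).
Proof.
apply/quotmod_piP; rewrite opprD addrACA.
by rewrite rpredD ?quotmod_repr.
Qed.

Lemma quotmod_oppE x : quotmod_opp (quotmod_pi x) = quotmod_pi (- x).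
Proof. by apply/quotmod_piP; rewrite -opprD submod_memN quotmod_repr. Qed.

Lemma quotmod_scaleE a x :
  quotmod_scale a (quotmod_pi x) = quotmod_pi (a *: x).
Proof. by apply/quotmod_piP; rewrite -scalerBr rpredZ ?quotmod_repr. Qed.

Lemma quotmod_addA : associative quotmod_add.
Proof.
move=> p q r; rewrite -[p]quotmod_reprK -[q]quotmod_reprK -[r]quotmod_reprK.
by rewrite !quotmod_addE addrA.
Qed.

Lemma quotmod_addC : commutative quotmod_add.
Proof.
move=> p q; rewrite -[p]quotmod_reprK -[q]quotmod_reprK.
by rewrite !quotmod_addE addrC.
Qed.

Lemma quotmod_add0 : left_id (quotmod_pi 0) quotmod_add.
Proof. by move=> p; rewrite -[p]quotmod_reprK quotmod_addE add0r. Qed.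

Lemma quotmod_addN : left_inverse (quotmod_pi 0) quotmod_opp quotmod_add.
Proof.
by move=> p; rewrite -[p]quotmod_reprK quotmod_oppE quotmod_addE addNr.
Qed.

HB.instance Definition _ := GRing.isZmodule.Build quotmod
  quotmod_addA quotmod_addC quotmod_add0 quotmod_addN.

Lemma quotmod_scaleA a b p :
  quotmod_scale a (quotmod_scale b p) = quotmod_scale (a * b) p.
Proof. by rewrite -[p]quotmod_reprK !quotmod_scaleE scalerA. Qed.

Lemma quotmod_scale1 : left_id 1 quotmod_scale.
Proof. by move=> p; rewrite -[p]quotmod_reprK quotmod_scaleE scale1r. Qed.

Lemma quotmod_scaleDr : right_distributive quotmod_scale +%R.
Proof.
move=> a p q; rewrite -[p]quotmod_reprK -[q]quotmod_reprK.
rewrite [LHS](congr1 (quotmod_scale a) (quotmod_addE _ _)) !quotmod_scaleE.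
by rewrite scalerDr [RHS]quotmod_addE.
Qed.

Lemma quotmod_scaleDl p : {morph quotmod_scale^~ p : a b / a + b}.
Proof.
move=> a b; rewrite -[p]quotmod_reprK !quotmod_scaleE scalerDl.
by rewrite [RHS]quotmod_addE.
Qed.

HB.instance Definition _ := GRing.Zmodule_isLmodule.Build R quotmod
  quotmod_scaleA quotmod_scale1 quotmod_scaleDr quotmod_scaleDl.

Lemma quotmod_pi_is_linear : linear quotmod_pi.
Proof.
move=> a x y; rewrite -[RHS]/(quotmod_add (quotmod_scale _ _) _).
by rewrite quotmod_scaleE quotmod_addE.
Qed.

HB.instance Definition _ :=
  GRing.isLinear.Build R V quotmod _ quotmod_pi quotmod_pi_is_linear.

End QuotientModule.

Section QuotientSpace.
Variables (R : realType) (Y : normedModType R) (Z : submodClosed Y).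
Hypothesis cZ : closed [set` Z].

Definition quotient_space of closed [set` Z] : Type := quotmod Z.
Local Notation Q := (quotient_space cZ).
HB.instance Definition _ := GRing.Lmodule.copy Q (quotmod Z).

Definition quotient_norm (q : Q) : R :=
  inf [set `|y| | y in [set y | quotmod_pi Z y = q]].

Let has_inf_coset (q : Q) :
  has_inf [set `|y| | y in [set y | quotmod_pi Z y = q]].
Proof.
split; first by exists `|repr q|, (repr q) => //; exact: quotmod_reprK.
by exists 0 => _ [y _ <-].
Qed.

Let quotient_norm_le (y : Y) : quotient_norm (quotmod_pi Z y) <= `|y|.
Proof. by apply: ge_inf; [case: (has_inf_coset (quotmod_pi Z y))|exists y]. Qed.

Let quotient_norm_ge0 (q : Q) : 0 <= quotient_norm q.
Proof. by apply: lb_le_inf; [case: (has_inf_coset q)|move=> _ [y _ <-]]. Qed.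

Let quotient_norm_lt (q : Q) e : 0 < e ->
  exists2 y, quotmod_pi Z y = q & `|y| < quotient_norm q + e.
Proof.
move=> e0; have [_ [y yq <-] ye] := inf_adherent e0 (has_inf_coset q).
by exists y.
Qed.

Lemma ler_quotient_normD (p q : Q) :
  quotient_norm (p + q) <= quotient_norm p + quotient_norm q.
Proof.
apply/ler_addgt0Pl => e e0; have e20 : 0 < e / 2 by rewrite divr_gt0.
have [x xp xe] := quotient_norm_lt p e20.
have [y yq ye] := quotient_norm_lt q e20.
have -> : p + q = quotmod_pi Z (x + y) by rewrite linearD /= xp yq.
apply: (le_trans (quotient_norm_le _)); apply: (le_trans (ler_normD _ _)).
rewrite [leRHS](_ : _ = (quotient_norm p + e / 2) + (quotient_norm q + e / 2)).
  by rewrite ltW// ltrD.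
by rewrite addrACA -splitr addrC.
Qed.

Let ler_quotient_normZ a (q : Q) :
  quotient_norm (a *: q) <= `|a| * quotient_norm q.
Proof.
apply/ler_addgt0Pl => e e0.
have a0 : 0 < `|a| + 1 by rewrite ltr_wpDl.
have [x xq xe] := quotient_norm_lt q (divr_gt0 e0 a0).
have -> : a *: q = quotmod_pi Z (a *: x) by rewrite linearZ /= xq.
apply: (le_trans (quotient_norm_le _)); rewrite normrZ.
apply: (le_trans (ler_wpM2l (normr_ge0 _) (ltW xe))).
rewrite mulrDr addrC lerD2r mulrCA -[leRHS]mulr1.
by apply: ler_wpM2l; [exact: ltW|rewrite ler_pdivrMr// mul1r lerDl].
Qed.

Lemma quotient_normZ a (q : Q) :
  quotient_norm (a *: q) = `|a| * quotient_norm q.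
Proof.
apply/eqP; rewrite eq_le ler_quotient_normZ /=.
have [->|a0] := eqVneq a 0; first by rewrite normr0 mul0r.
have := ler_quotient_normZ a^-1 (a *: q).
by rewrite scalerA mulVf// scale1r normfV ler_pdivlMl// normr_gt0.
Qed.

Lemma quotient_norm0_eq0 (q : Q) : quotient_norm q = 0 -> q = 0.
Proof.
move=> q0; rewrite -[q](quotmod_reprK) -(linear0 (quotmod_pi Z)).
apply/quotmod_piP; rewrite subr0.
suff : closure [set` Z] (repr q) by move/cZ.
move=> B /nbhs_ballP[e /= e0 eB].
have [y yq ye] := quotient_norm_lt q e0.
exists (repr q - y); split.
  by apply/quotmod_piP; rewrite quotmod_reprK.
apply: eB; rewrite -ball_normE /= opprB addrC subrK.
by rewrite q0 add0r in ye.
Qed.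

HB.instance Definition _ := Lmodule_isNormed.Build R Q
  ler_quotient_normD quotient_normZ quotient_norm0_eq0.

End QuotientSpace.

Section Completion.
Variables (R : realType) (V : lmodType R).

Record is_seminorm (p : V -> R) : Prop := IsSeminorm {
  seminormD : forall x y, p (x + y) <= p x + p y ;
  seminormZ : forall a x, p (a *: x) = `|a| * p x }.

Variables (p : V -> R) (sp : is_seminorm p).

Lemma seminorm0 : p 0 = 0.
Proof. by rewrite -(scale0r 0) (seminormZ sp) normr0 mul0r. Qed.

Lemma seminormN x : p (- x) = p x.
Proof. by rewrite -scaleN1r (seminormZ sp) normrN1 mul1r. Qed.

Lemma seminormB x y : p (x - y) = p (y - x).
Proof. by rewrite -seminormN opprB. Qed.

Lemma seminorm_ge0 x : 0 <= p x.
Proof.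
have := seminormD sp x (- x); rewrite subrr seminorm0 seminormN.
by rewrite -mulr2n pmulrn_lge0.
Qed.

Lemma ler_seminorm_dist x y : `|p x - p y| <= p (x - y).
Proof.
rewrite ler_norml; apply/andP; split; last rewrite lerBlDr.
  rewrite lerNl opprB lerBlDr seminormB.
  by have := seminormD sp (y - x) x; rewrite subrK addrC.
by have := seminormD sp (x - y) y; rewrite subrK.
Qed.

Definition seminorm_cauchy (u : nat -> V) : Prop := forall e, 0 < e ->
  exists N, forall m n, (N <= m)%N -> (N <= n)%N -> p (u m - u n) < e.

Definition seminorm_cauchy_pred of is_seminorm p : {pred (nat -> V)} :=
  fun u => `[< seminorm_cauchy u >].

Lemma seminorm_cauchy_submod : submod_closed (seminorm_cauchy_pred sp).
Proof.
split.
  by apply/asboolP => e e0; exists 0%N => m n _ _; rewrite subrr seminorm0.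
move=> a u v /asboolP cu /asboolP cv; apply/asboolP => e e0.
have a0 : 0 < `|a| + 1 by rewrite ltr_wpDl.
have e20 : 0 < e / 2 by rewrite divr_gt0.
have [N1 h1] := cu _ (divr_gt0 e20 a0).
have [N2 h2] := cv _ e20.
exists (maxn N1 N2) => m n; rewrite !geq_max => /andP[m1 m2] /andP[n1 n2].
have -> : (a *: u + v) m - (a *: u + v) n = a *: (u m - u n) + (v m - v n).
  by rewrite scalerBr opprD addrACA.
apply: (le_lt_trans (seminormD sp _ _)); rewrite [ltRHS]splitr.
apply: ler_ltD; last exact: h2.
rewrite (seminormZ sp).
apply: (@le_trans _ _ ((`|a| + 1) * p (u m - u n))).
  by rewrite ler_wpM2r ?seminorm_ge0// lerDl.
by rewrite mulrC -ler_pdivlMr// ltW// h1.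
Qed.

HB.instance Definition _ :=
  GRing.isSubmodClosed.Build R _ (seminorm_cauchy_pred sp)
    seminorm_cauchy_submod.

Record cauchy_seq := CauchySeq
  { cauchy_val :> nat -> V ; _ : cauchy_val \in seminorm_cauchy_pred sp }.
HB.instance Definition _ := [isSub for cauchy_val].
HB.instance Definition _ := [Choice of cauchy_seq by <:].
HB.instance Definition _ := [SubChoice_isSubLmodule of cauchy_seq by <:].

Lemma cauchy_seqP (u : cauchy_seq) : seminorm_cauchy u.
Proof. by apply/asboolP; exact: (valP u). Qed.

Lemma cvg_seminorm (u : cauchy_seq) : cvgn (p \o u).
Proof.
apply/cauchy_cvgP/cauchyP => e e0.
have [N h] := cauchy_seqP u e0.
exists (p (u N)); exists N => // n /= Nn; rewrite -ball_normE /=.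
by apply: (le_lt_trans (ler_seminorm_dist _ _)); exact: h.
Qed.

Definition null_seq : {pred cauchy_seq} := fun u => `[< p \o u @ \oo --> 0 >].

Lemma null_seq_submod : submod_closed null_seq.
Proof.
split.
  apply/asboolP; rewrite (_ : _ \o _ = cst 0); first exact: cvg_cst.
  by apply/funext => n /=; rewrite seminorm0.
move=> a u v /asboolP u0 /asboolP v0; apply/asboolP.
have h : (fun n => `|a| * p (u n) + p (v n)) @ \oo --> 0.
  rewrite -[0]addr0 -[X in X + _](mulr0 `|a|).
  by apply: cvgD => //; apply: cvgMr.
apply: (squeeze_cvgr _ (cvg_cst 0) h); near=> n.
by rewrite seminorm_ge0 -(seminormZ sp) (seminormD sp).
Unshelve. all: by end_near. Qed.

HB.instance Definition _ :=
  GRing.isSubmodClosed.Build R _ null_seq null_seq_submod.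

(* Cauchy sequences modulo null sequences. Since all the sequences with
   p (u n) --> 0 are identified with 0, this makes sense for a seminorm p; it is
   the usual completion when p is a norm. *)
Definition completion : Type := quotmod null_seq.
HB.instance Definition _ := GRing.Lmodule.on completion.

Definition completion_norm (x : completion) : R := limn (p \o repr x).

Lemma completion_normE (u : cauchy_seq) :
  completion_norm (quotmod_pi null_seq u) = limn (p \o u).
Proof.
set w := repr (quotmod_pi null_seq u).
have /asboolP wu : w - u \in null_seq by exact: quotmod_repr.
apply/eqP; rewrite -subr_eq0 -limB; try exact: cvg_seminorm.
apply/eqP/cvg_lim => //.
have nwu : - (p \o (w - u)) @ \oo --> 0 by rewrite -oppr0; exact: cvgN.
apply: (squeeze_cvgr _ nwu wu); near=> n.
by have := ler_seminorm_dist (w n) (u n); rewrite ler_norml.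
Unshelve. all: by end_near. Qed.

Lemma completion_normD (x y : completion) :
  completion_norm (x + y) <= completion_norm x + completion_norm y.
Proof.
rewrite -[x]quotmod_reprK -[y]quotmod_reprK -linearD !completion_normE.
rewrite -limD; try exact: cvg_seminorm.
apply: ler_lim; first exact: cvg_seminorm.
  by apply: is_cvgD; exact: cvg_seminorm.
by near=> n; exact: (seminormD sp).
Unshelve. all: by end_near. Qed.

Lemma completion_normZ a (x : completion) :
  completion_norm (a *: x) = `|a| * completion_norm x.
Proof.
rewrite -[x]quotmod_reprK -linearZ !completion_normE; apply/cvg_lim => //.
set u := repr x; rewrite (_ : _ \o _ = fun n => `|a| * p (u n)).
  by apply: cvgMr; exact: cvg_seminorm.
by apply/funext => n; exact: (seminormZ sp).
Qed.

Lemma completion_norm0_eq0 (x : completion) : completion_norm x = 0 -> x = 0.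
Proof.
move=> x0; rewrite -[x]quotmod_reprK -(linear0 (quotmod_pi null_seq)).
apply/quotmod_piP; rewrite subr0; apply/asboolP.
by rewrite -x0; exact: cvg_seminorm.
Qed.

HB.instance Definition _ := Lmodule_isNormed.Build R completion
  completion_normD completion_normZ completion_norm0_eq0.

Lemma seminorm_cauchy_cst (x : V) : cst x \in seminorm_cauchy_pred sp.
Proof. by apply/asboolP => e e0; exists 0%N => m n _ _; rewrite subrr seminorm0. Qed.

Definition completion_embed (x : V) : completion :=
  quotmod_pi null_seq (CauchySeq (seminorm_cauchy_cst x)).

Lemma norm_completion_embed x : `|completion_embed x| = p x.
Proof.
rewrite [LHS]completion_normE; apply/cvg_lim => //.
by rewrite (_ : _ \o _ = cst (p x)) //; exact: cvg_cst.
Qed.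

Lemma completion_embed_is_linear : linear completion_embed.
Proof.
move=> a x y; rewrite /completion_embed -linearP; congr quotmod_pi.
exact/val_inj.
Qed.

HB.instance Definition _ :=
  GRing.isLinear.Build R V completion _ completion_embed
    completion_embed_is_linear.

Let ler_dist_completion_embed (u : cauchy_seq) N e :
    (forall n, (N <= n)%N -> p (u n - u N) <= e) ->
  `|(quotmod_pi null_seq u : completion) - completion_embed (u N)| <= e.
Proof.
move=> h; rewrite -linearB [leLHS]completion_normE.
apply: limr_le; first exact: cvg_seminorm.
by exists N => // n /= Nn; exact: h.
Qed.

Lemma completion_embed_dense (x : completion) e : 0 < e ->
  exists v, `|x - completion_embed v| < e.
Proof.
move=> e0; have e20 : 0 < e / 2 by rewrite divr_gt0.
have [N h] := cauchy_seqP (repr x) e20.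
exists (repr x N); rewrite -[X in X - _]quotmod_reprK.
apply: (@le_lt_trans _ _ (e / 2)); last by rewrite ltr_pdivrMr// ltr_pMr// ltr1n.
by apply: ler_dist_completion_embed => n Nn; rewrite ltW// h.
Qed.

Lemma completion_cauchy_cvg (F : set_system completion) :
  ProperFilter F -> cauchy F -> cvg F.
Proof.
move=> FF /cauchyP cF.
have /choice[v vF] (n : nat) :
    exists v, F (ball (completion_embed v) n.+1%:R^-1).
  have d0 : 0 < (n.+1%:R^-1 : R) / 2 by rewrite divr_gt0.
  have [c cn] := cF _ d0.
  have [v cv] := completion_embed_dense c d0.
  exists v; apply: filterS cn => z; rewrite -!ball_normE /= => cz.
  rewrite [ltRHS]splitr; apply: le_lt_trans (ler_distD c _ _) _.
  by rewrite ltrD// distrC.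
have vv m n : p (v m - v n) < m.+1%:R^-1 + n.+1%:R^-1.
  have [z []] := filter_ex (filterI (vF m) (vF n)).
  rewrite -!ball_normE /= => mz nz.
  rewrite -norm_completion_embed linearB.
  apply: le_lt_trans (ler_distD z _ _) _.
  by rewrite ltrD// distrC.
have small e : 0 < e ->
    exists N, forall n, (N <= n)%N -> (n.+1%:R^-1 : R) < e.
  move=> e0; have [N _ hN] := near_infty_natSinv_lt (PosNum e0).
  by exists N => n; exact: hN.
have cv : v \in seminorm_cauchy_pred sp.
  apply/asboolP => e e0; have e20 : 0 < e / 2 by rewrite divr_gt0.
  have [N h] := small _ e20; exists N => m n Nm Nn.
  by apply: (lt_trans (vv m n)); rewrite [ltRHS]splitr ltrD// h.
apply/cvg_ex; exists (quotmod_pi null_seq (CauchySeq cv) : completion).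
apply/cvg_ballP => e e0; have e30 : 0 < e / 3 by rewrite divr_gt0.
have [N h] := small _ e30.
apply: filterS (vF N) => z; rewrite -!ball_normE /= => Nz.
apply: le_lt_trans (ler_distD (completion_embed (v N)) _ _) _.
rewrite (_ : e = (e / 3 + e / 3) + e / 3); last by field.
apply: ler_ltD; last by apply: (lt_trans Nz); exact: h.
apply: (ler_dist_completion_embed (u := CauchySeq cv)) => n Nn.
by apply: (le_trans (ltW (vv n N))); rewrite lerD// ltW// h.
Qed.

HB.instance Definition _ :=
  Uniform_isComplete.Build completion completion_cauchy_cvg.

End Completion.

Section SubmoduleSpan.
Variables (R : pzRingType) (V : lmodType R) (G : set V).

Definition submod_span : {pred V} := fun u =>
  `[< smallest [set W : set V | submod_closed (fun x => `[< W x >])] G u >].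

Lemma submod_span_closed : submod_closed submod_span.
Proof.
split; first by apply/asboolP => W [[/asboolP W0 _] _].
move=> a u v /asboolP hu /asboolP hv; apply/asboolP => W WG.
have [[_ Wl] _] := WG; apply/asboolP/Wl; apply/asboolP.
- exact: hu.
- exact: hv.
Qed.

HB.instance Definition _ :=
  GRing.isSubmodClosed.Build R V submod_span submod_span_closed.

Lemma submod_span_sub u : G u -> u \in submod_span.
Proof. by move=> Gu; apply/asboolP => W [_ GW]; exact: GW. Qed.

End SubmoduleSpan.

Section AlgebraicTensorProduct.
Variables (R : realType) (X : lmodType R) (n : nat).

Definition upd (x : {ffun 'I_n -> X}) (i : 'I_n) (y : X) : {ffun 'I_n -> X} :=
  [ffun j => if j == i then y else x j].

(* [malg K R] is the free R-module on K, and [mkmalgU k 1] the basis vector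
   attached to k : K. *)
Definition multilinear_relations : set (malg {ffun 'I_n -> X} R) :=
  [set r | exists (x : {ffun 'I_n -> X}) (i : 'I_n) (a : R) (y z : X),
    r = mkmalgU (upd x i (a *: y + z)) 1
        - (a *: mkmalgU (upd x i y) 1 + mkmalgU (upd x i z) 1)].

Definition algtensor : Type := quotmod (submod_span multilinear_relations).
HB.instance Definition _ := GRing.Lmodule.on algtensor.

Definition pure_tensor (x : {ffun 'I_n -> X}) : algtensor :=
  quotmod_pi (submod_span multilinear_relations) (mkmalgU x 1).

Lemma pure_tensorP x i a y z : pure_tensor (upd x i (a *: y + z)) =
  a *: pure_tensor (upd x i y) + pure_tensor (upd x i z).
Proof.
rewrite /pure_tensor -linearP; apply/quotmod_piP.
by apply: submod_span_sub; exists x, i, a, y, z.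
Qed.

Lemma upd_id x i : upd x i (x i) = x.
Proof. by apply/ffunP => j; rewrite ffunE; case: eqP => [->|]. Qed.

Lemma pure_tensor0 x i : pure_tensor (upd x i 0) = 0.
Proof.
have := pure_tensorP x i 1 0 0; rewrite scale1r addr0 scale1r => /eqP.
by rewrite -subr_eq subrr => /eqP.
Qed.

Lemma pure_tensorZ x i a : pure_tensor (upd x i (a *: x i)) = a *: pure_tensor x.
Proof.
by rewrite -[a *: x i]addr0 pure_tensorP pure_tensor0 addr0 upd_id.
Qed.

Lemma algtensor_gen (n_gt0 : (0 < n)%N) (u : algtensor) :
  exists s : seq {ffun 'I_n -> X}, u = \sum_(x <- s) pure_tensor x.
Proof.
rewrite -[u]quotmod_reprK [repr u]monalgE linear_sum /=.
pose i := Ordinal n_gt0.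
exists [seq upd k i (mcoeff k (repr u) *: k i) | k <- finmap.enum_fset (msupp (repr u))].
rewrite big_map; apply: eq_bigr => k _.
rewrite pure_tensorZ /pure_tensor -linearZ; congr quotmod_pi.
by apply/malgP => k'; rewrite mcoeffZ !mcoeffU mulrnAr mulr1.
Qed.

End AlgebraicTensorProduct.

Section ProjectiveTensorProduct.
Variables (R : realType) (X : normedModType R) (n : nat).

Definition projective_norm (u : algtensor X n) : R :=
  inf [set \sum_(x <- s) \prod_(i < n) `|x i| |
    s in [set s : seq {ffun 'I_n -> X} | u = \sum_(x <- s) pure_tensor x]].

Hypothesis n_gt0 : (0 < n)%N.

Let cost_ge0 (s : seq {ffun 'I_n -> X}) :
  0 <= \sum_(x <- s) \prod_(i < n) `|x i|.
Proof. by apply: sumr_ge0 => x _; apply: prodr_ge0. Qed.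

Let has_inf_cost (u : algtensor X n) : has_inf
  [set \sum_(x <- s) \prod_(i < n) `|x i| |
    s in [set s : seq {ffun 'I_n -> X} | u = \sum_(x <- s) pure_tensor x]].
Proof.
split; last by exists 0 => _ [s _ <-].
by have [s us] := algtensor_gen n_gt0 u; eexists; exists s.
Qed.

Let projective_norm_le (s : seq {ffun 'I_n -> X}) :
  projective_norm (\sum_(x <- s) pure_tensor x) <=
  \sum_(x <- s) \prod_(i < n) `|x i|.
Proof.
by apply: ge_inf; [case: (has_inf_cost (\sum_(x <- s) pure_tensor x))|exists s].
Qed.

Let projective_norm_ge0 u : 0 <= projective_norm u.
Proof. by apply: lb_le_inf; [case: (has_inf_cost u)|move=> _ [s _ <-]]. Qed.

Let projective_norm_lt u e : 0 < e ->
  exists2 s : seq {ffun 'I_n -> X}, u = \sum_(x <- s) pure_tensor x &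
    \sum_(x <- s) \prod_(i < n) `|x i| < projective_norm u + e.
Proof.
move=> e0; have [_ [s us <-] se] := inf_adherent e0 (has_inf_cost u).
by exists s.
Qed.

Let projective_normD u v :
  projective_norm (u + v) <= projective_norm u + projective_norm v.
Proof.
apply/ler_addgt0Pl => e e0; have e20 : 0 < e / 2 by rewrite divr_gt0.
have [s us se] := projective_norm_lt u e20.
have [t vt te] := projective_norm_lt v e20.
have -> : u + v = \sum_(x <- s ++ t) pure_tensor x by rewrite big_cat us vt.
apply: (le_trans (projective_norm_le _)); rewrite big_cat /=.
apply: (le_trans (ltW (ltrD se te))).
by rewrite addrACA -splitr addrC.
Qed.

Let ler_projective_normZ a u :
  projective_norm (a *: u) <= `|a| * projective_norm u.
Proof.
apply/ler_addgt0Pl => e e0.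
have a0 : 0 < `|a| + 1 by rewrite ltr_wpDl.
have [s us se] := projective_norm_lt u (divr_gt0 e0 a0).
pose i := Ordinal n_gt0.
have -> : a *: u =
    \sum_(x <- [seq upd x i (a *: x i) | x <- s]) pure_tensor x.
  by rewrite us scaler_sumr big_map; apply: eq_bigr => x _; rewrite pure_tensorZ.
apply: (le_trans (projective_norm_le _)).
rewrite big_map.
rewrite (eq_bigr (fun x : {ffun 'I_n -> X} => `|a| * \prod_(i < n) `|x i|)).
  rewrite -mulr_sumr; apply: (le_trans (ler_wpM2l (normr_ge0 _) (ltW se))).
  rewrite mulrDr addrC lerD2r mulrCA -[leRHS]mulr1.
  by apply: ler_wpM2l; [exact: ltW|rewrite ler_pdivrMr// mul1r lerDl].
move=> x _; rewrite (bigD1 i)//= [in RHS](bigD1 i)//= mulrA -normrZ ffunE eqxx.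
by congr (_ * _); apply: eq_bigr => j /negPf ji; rewrite ffunE ji.
Qed.

Lemma projective_norm_seminorm : is_seminorm projective_norm.
Proof.
split=> [|a u]; first exact: projective_normD.
apply/eqP; rewrite eq_le ler_projective_normZ /=.
have [->|a0] := eqVneq a 0; first by rewrite normr0 mul0r.
have := ler_projective_normZ a^-1 (a *: u).
by rewrite scalerA mulVf// scale1r normfV ler_pdivlMl// normr_gt0.
Qed.

End ProjectiveTensorProduct.

(* The n-fold projective tensor product of X with itself. For n = 0 the sums of
   elementary tensors (without coefficients) would not exhaust the algebraic
   tensor product, and [projective_norm] would not be a seminorm. *)
Definition projtensor (R : realType) (X : normedModType R) (n : nat)
  (n_gt0 : (0 < n)%N) : completeNormedModType R :=
  completion (projective_norm_seminorm X n_gt0).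
Arguments projtensor {R} X n n_gt0.

Section ContinuousFunctions.
Variables (R : realType) (K : topologicalType).

Definition continuous_pred : {pred (K -> R)} := fun f => `[< continuous f >].

Lemma continuous_pred_submod : submod_closed continuous_pred.
Proof.
split; first by apply/asboolP => x; exact: cvg_cst.
move=> a f g /asboolP cf /asboolP cg; apply/asboolP => x.
by apply: cvgD; [apply: cvgZr; exact: cf|exact: cg].
Qed.

HB.instance Definition _ :=
  GRing.isSubmodClosed.Build R (K -> R) continuous_pred continuous_pred_submod.

Record contfun := ContFun
  { contfun_val :> K -> R ; _ : contfun_val \in continuous_pred }.
HB.instance Definition _ := [isSub for contfun_val].
HB.instance Definition _ := [Choice of contfun by <:].
HB.instance Definition _ := [SubChoice_isSubLmodule of contfun by <:].

Lemma contfun_continuous (f : contfun) : continuous f.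
Proof. by apply/asboolP; exact: (valP f). Qed.

Hypothesis cK : compact [set: K].

(* C(K): the compactness proof makes the supremum norm well-defined. *)
Definition CK of compact [set: K] : Type := contfun.
HB.instance Definition _ := GRing.Lmodule.copy (CK cK) contfun.

Definition sup_norm (f : CK cK) : R := sup (range (fun x => `|f x|)).

Let sup_norm_ub (f : CK cK) x : `|f x| <= sup_norm f.
Proof.
apply: ub_le_sup; last by exists x.
have cnf : continuous (fun x => `|f x|).
  by move=> y; apply: cvg_norm; exact: contfun_continuous.
have [|c _ hc] := compact_EVT_max _ cK (continuous_subspaceT cnf).
  by exists x.
by exists `|f c| => _ [y _ <-]; apply: hc; rewrite inE.
Qed.

Let sup_norm_le (f : CK cK) M :
  0 <= M -> (forall x, `|f x| <= M) -> sup_norm f <= M.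
Proof.
move=> M0 fM; have [[y Sy]|S0] := pselect (range (fun x => `|f x|) !=set0).
  by apply: ge_sup; [exists y|move=> _ [x _ <-]].
by rewrite /sup_norm sup_out// => -[/S0].
Qed.

Let sup_norm_ge0 (f : CK cK) : 0 <= sup_norm f.
Proof.
have [[_ [x _ _]]|S0] := pselect (range (fun x => `|f x|) !=set0).
  exact: le_trans (sup_norm_ub f x).
by rewrite /sup_norm sup_out// => -[/S0].
Qed.

Lemma ler_sup_normD (f g : CK cK) : sup_norm (f + g) <= sup_norm f + sup_norm g.
Proof.
apply: sup_norm_le => [|x]; first by rewrite addr_ge0.
by apply: (le_trans (ler_normD _ _)); rewrite lerD.
Qed.

Lemma sup_normZ a (f : CK cK) : sup_norm (a *: f) = `|a| * sup_norm f.
Proof.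
have le b (h : CK cK) : sup_norm (b *: h) <= `|b| * sup_norm h.
  apply: sup_norm_le => [|x]; first by rewrite mulr_ge0.
  by rewrite [X in `|X|](_ : _ = b * h x)// normrM ler_wpM2l.
apply/eqP; rewrite eq_le le /=.
have [->|a0] := eqVneq a 0; first by rewrite normr0 mul0r.
have := le a^-1 (a *: f).
by rewrite scalerA mulVf// scale1r normfV ler_pdivlMl// normr_gt0.
Qed.

Lemma sup_norm0_eq0 (f : CK cK) : sup_norm f = 0 -> f = 0.
Proof.
move=> f0; apply/val_inj/funext => x /=.
by apply/eqP; rewrite -normr_le0 -f0.
Qed.

HB.instance Definition _ := Lmodule_isNormed.Build R (CK cK)
  ler_sup_normD sup_normZ sup_norm0_eq0.

End ContinuousFunctions.
Arguments CK R {K} cK.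

Definition isomorphic (R : realType) (U V : normedModType R) : Prop :=
  exists (f : {linear U -> V}) (g : {linear V -> U}),
    [/\ continuous f, continuous g, cancel f g & cancel g f].

(* Main.v *)
Require Import Defs.
From mathcomp Require Import all_boot all_order all_algebra finmap.
From mathcomp Require Import -(notations) monalg.
From mathcomp Require Import all_classical all_reals all_analysis ring lra.
Import Order.TTheory GRing.Theory Num.Theory numFieldNormedType.Exports.
Local Open Scope classical_set_scope.
Local Open Scope ring_scope.

Set Implicit Arguments.
Unset Strict Implicit.
Unset Printing Implicit Defensive.

(** Why the 3-fold product is not a quotient of the 2-fold one.

Suppose that q maps the 2-fold product boundedly onto the 3-fold one, with
bounded lifts. A functional on the 3-fold product then pulls back to a functional
on the 2-fold product, that is, to a bounded bilinear form on C(K), with an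
equivalent norm. The contradiction comes from a family of functionals on the
3-fold product whose pullbacks would be too small for bilinear forms.

On the 3-fold side, choose a Rademacher system on 2 ^ k points of K. Its k
coefficient functionals phi_n on C(K) satisfy Bessel's inequality, so the forms
phi_n(x) phi_n(y) have sums with arbitrary signs bounded by |x| |y|, although each
of them has norm 1. For points t of K put Phi_(n,t)(x, y, z) =
phi_n(x) phi_n(y) z(t). All sums of the differences
Phi_(n,t_n) - Phi_(n,t'_n) with arbitrary signs have norm at most 2, whatever k is,
while each difference with t_n <> t'_n has norm at least 1
([rademacher_form_signs], [rademacher_form_separated]).

On the 2-fold side this is impossible for large k. Since K is countable and
compact, a functional on C(K) is given by its atoms ([atoms_le],
[atoms_approx]; this is the identification of the dual of C(K) with l_1(K)), so a
bilinear form is given by an infinite matrix indexed by an enumeration of K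
([bilinear_matrix_form_le], [bilinear_matrix_approx]). For each n in turn the points
t_n and t'_n are chosen by the pigeonhole principle such that the n-th difference
has a matrix which is almost 0 on the finite corner reached by the previous
ones ([pigeonhole_corner]). Then a vector x_n supported outside this corner, or
such a vector on the side of the columns, makes the n-th matrix large
([separated_outside_corner]). The vectors x_n have disjoint supports, so all their
signed sums have norm at most 1; Khinchine's inequality, which expresses that l_1
has cotype 2, makes the signed sums of the matrices grow at least like the square
root of k on them ([disjoint_rows], [signed_family_bound]). This contradicts the
bound 2 |q|. *)

(** * Averages over signs *)

Section Rademacher.
Variables (R : realType) (k : nat).
Implicit Types (s : {ffun 'I_k -> bool}) (X Y : {ffun 'I_k -> bool} -> R).

Definition rademacher s (i : 'I_k) : R := (-1) ^+ s i.

Definition mean X : R := (2 ^+ k)^-1 * \sum_s X s.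

Lemma rademacherM s i : rademacher s i * rademacher s i = 1.
Proof. by rewrite -expr2 /rademacher sqrr_sign. Qed.

Lemma rademacher_norm s i : `|rademacher s i| = 1.
Proof. by rewrite /rademacher normr_sign. Qed.

Lemma eq_mean X Y : X =1 Y -> mean X = mean Y.
Proof. by move=> XY; congr (_ * _); apply: eq_bigr. Qed.

Lemma meanD X Y : mean (fun s => X s + Y s) = mean X + mean Y.
Proof. by rewrite /mean big_split mulrDr. Qed.

Lemma meanZ a X : mean (fun s => a * X s) = a * mean X.
Proof. by rewrite /mean -mulr_sumr mulrCA. Qed.

Lemma meanB X Y : mean (fun s => X s - Y s) = mean X - mean Y.
Proof. by rewrite /mean sumrB mulrBr. Qed.

Lemma mean_sum I (r : seq I) (P : pred I) (X : I -> {ffun 'I_k -> bool} -> R) :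
  mean (fun s => \sum_(i <- r | P i) X i s) = \sum_(i <- r | P i) mean (X i).
Proof. by rewrite /mean exchange_big mulr_sumr. Qed.

Lemma mean_cst a : mean (fun=> a) = a.
Proof.
rewrite /mean sumr_const card_ffun card_bool card_ord -[a *+ _]mulr_natl mulrA.
by rewrite natrX mulVf ?mul1r// expf_neq0.
Qed.

Lemma le_mean X Y : (forall s, X s <= Y s) -> mean X <= mean Y.
Proof. by move=> XY; rewrite ler_wpM2l ?invr_ge0 ?exprn_ge0// ler_sum. Qed.

Lemma mean_le X a : (forall s, X s <= a) -> mean X <= a.
Proof. by move=> Xa; rewrite -[leRHS]mean_cst le_mean. Qed.

Lemma ler_norm_mean X : `|mean X| <= mean (fun s => `|X s|).
Proof.
rewrite /mean normrM ger0_norm ?invr_ge0 ?exprn_ge0//.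
by rewrite ler_wpM2l ?invr_ge0 ?exprn_ge0// ler_norm_sum.
Qed.

Definition flip (i : 'I_k) s := [ffun j => (j == i) (+) s j].

Lemma flipK i : involutive (flip i).
Proof. by move=> s; apply/ffunP => j; rewrite !ffunE addKb. Qed.

(** Reindexing by the change of the i-th sign turns the mean into its opposite. *)
Lemma mean_odd i X : (forall s, X (flip i s) = X s) ->
  mean (fun s => X s * rademacher s i) = 0.
Proof.
move=> Xi; apply/eqP; rewrite -eqNr; apply/eqP.
rewrite /mean -mulrN -sumrN; congr (_ * _).
rewrite [RHS](reindex_inj (inv_inj (flipK i))) /=.
apply: eq_bigr => s _.
by rewrite Xi /rademacher ffunE eqxx signr_addb mulN1r mulrN.
Qed.

Lemma rademacher_flip i j s : i != j -> rademacher (flip i s) j = rademacher s j.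
Proof. by move=> ij; rewrite /rademacher ffunE eq_sym (negPf ij). Qed.

Lemma mean_rademacher i j :
  mean (fun s => rademacher s i * rademacher s j) = (i == j)%:R.
Proof.
have [->|ij] := eqVneq i j; last first.
  by apply: mean_odd => s; rewrite rademacher_flip// eq_sym.
by under eq_mean do rewrite rademacherM; rewrite mean_cst.
Qed.

Variable c : 'I_k -> R.

Let S n s : R := \sum_(i < k | (i < n)%N) c i * rademacher s i.

Let S_rec (i : 'I_k) s : S i.+1 s = S i s + c i * rademacher s i.
Proof.
rewrite /S (bigD1 i) ?leqnn//= addrC; congr (_ + _); apply: eq_bigl => j.
by rewrite ltnS [(j < i)%N]ltn_neqAle andbC.
Qed.

Let S_flip (i : 'I_k) s : S i (flip i s) = S i s.
Proof.
apply: eq_bigr => j ji; rewrite rademacher_flip//.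
by apply: contraTneq ji => ->; rewrite ltnn.
Qed.

Let Q n : R := \sum_(i < k | (i < n)%N) c i ^+ 2.

Let Q_rec (i : 'I_k) : Q i.+1 = Q i + c i ^+ 2.
Proof.
rewrite /Q (bigD1 i) ?leqnn//= addrC; congr (_ + _); apply: eq_bigl => j.
by rewrite ltnS [(j < i)%N]ltn_neqAle andbC.
Qed.

Let mean_S2 n : (n <= k)%N -> mean (fun s => S n s ^+ 2) = Q n.
Proof.
elim: n => [_|n IH nk].
  rewrite /Q big_pred0// -[RHS]mean_cst; apply: eq_mean => s.
  by rewrite /S big_pred0// expr0n.
pose i := Ordinal nk; rewrite -[n]/(nat_of_ord i) Q_rec -IH; last exact: ltnW.
rewrite (_ : (fun s => _) = (fun s => (S n s ^+ 2 + c i ^+ 2) +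
   2 * c i * (S n s * rademacher s i))); last first.
  apply/funext => s; rewrite -[n.+1]/(i.+1) S_rec /=.
  have := rademacherM s i; set r := rademacher s i => r2.
  rewrite sqrrD exprMn [r ^+ 2]expr2 r2; ring.
by rewrite !meanD meanZ mean_odd ?mulr0 ?addr0 ?mean_cst// => s; exact: (S_flip i).
Qed.

Let mean_S4 n : (n <= k)%N -> mean (fun s => S n s ^+ 4) <= 3 * Q n ^+ 2.
Proof.
elim: n => [_|n IH nk].
  rewrite /Q /S big_pred0// mean_le// => s.
  by rewrite big_pred0// !expr0n mulr0.
pose i := Ordinal nk; rewrite -[n]/(nat_of_ord i) Q_rec.
rewrite (_ : (fun s => _) = (fun s => (S n s ^+ 4 + 6 * c i ^+ 2 * S n s ^+ 2
   + c i ^+ 4) +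
   (4 * c i * S n s ^+ 3 + 4 * c i ^+ 3 * S n s) * rademacher s i)); last first.
  apply/funext => s; rewrite -[n.+1]/(i.+1) S_rec /=.
  have := rademacherM s i; set r := rademacher s i => r2.
  have r4 : r ^+ 4 = 1 by rewrite (exprM r 2 2) [r ^+ 2]expr2 r2 expr1n.
  have r3 : r ^+ 3 = r by rewrite exprS expr2 r2 mulr1.
  rewrite -expr2 in r2.
  transitivity (S n s ^+ 4 + 4 * S n s ^+ 3 * c i * r
    + 6 * S n s ^+ 2 * c i ^+ 2 * r ^+ 2 + 4 * S n s * c i ^+ 3 * r ^+ 3
    + c i ^+ 4 * r ^+ 4); first by ring.
  by rewrite r2 r3 r4; ring.
rewrite meanD mean_odd ?addr0; last by move=> s; rewrite (S_flip i).
rewrite !meanD meanZ mean_cst (mean_S2 (ltnW nk)).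
have := IH (ltnW nk); rewrite -[Q i]/(Q n) => h.
rewrite [leRHS](_ : _ = 3 * Q n ^+ 2 + 6 * c i ^+ 2 * Q n + 3 * c i ^+ 4);
  last by ring.
rewrite lerD ?lerD//; have := exprn_even_ge0 (c i) (isT : ~~ odd 4); lra.
Qed.

(** Khinchine's inequality. The fourth moment of the sum is at most three times
the square of the second one, so the sum cannot concentrate near 0: this is
expressed by the mean of the pointwise bound [v ^+ 2 - v ^+ 4 / 6 <= v], where v is
the absolute value of the sum divided by its standard deviation. *)
Lemma khinchine :
  Num.sqrt (\sum_i c i ^+ 2) <= 2 * mean (fun s => `|\sum_i c i * rademacher s i|).
Proof.
have SE s : \sum_i c i * rademacher s i = S k s.
  by apply: eq_bigl => i; rewrite ltn_ord.
have QE : \sum_i c i ^+ 2 = Q k by apply: eq_bigl => i; rewrite ltn_ord.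
under eq_mean do rewrite SE.
rewrite QE; set q := Num.sqrt _.
have [q0|q0] := eqVneq q 0.
  rewrite q0 mulr_ge0// -(mean_cst 0).
  by apply: le_mean => s.
have Q0 : 0 <= Q k by apply: sumr_ge0 => i _; exact: sqr_ge0.
have qQ : q ^+ 2 = Q k by rewrite sqr_sqrtr.
have {q0} q0 : 0 < q by rewrite lt_neqAle eq_sym q0 sqrtr_ge0.
(* The cubic [v ^+ 3 / 6 - v + 1] has its minimum at sqrt 2, which is close to 7 / 5. *)
have aux (v : R) : 0 <= v -> v ^+ 2 - v ^+ 4 / 6 <= v.
  move=> v0.
  rewrite -subr_ge0.
  have -> : v - (v ^+ 2 - v ^+ 4 / 6) = v * (v ^+ 3 / 6 - v + 1) by ring.
  rewrite mulr_ge0//.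
  have [v2|v2] := leP v 2.
    have : 0 <= (v - 7 / 5) ^+ 2 * (v + 14 / 5).
      by rewrite mulr_ge0 ?sqr_ge0//; lra.
    by nra.
  have : 0 <= (v - 2) * (v ^+ 2 + 2 * v + 4).
    by rewrite mulr_ge0; [|lra|nra].
  have : 0 <= v ^+ 2 * (v - 2) by rewrite mulr_ge0 ?sqr_ge0//; lra.
  by nra.
have aux2 (t : R) : q^-1 * t ^+ 2 - (6 * q ^+ 3)^-1 * t ^+ 4 <= `|t|.
  have /aux : 0 <= `|t| / q by rewrite divr_ge0// ltW.
  rewrite !expr_div_n -normrX ger0_norm ?sqr_ge0//.
  rewrite -normrX ger0_norm ?exprn_even_ge0// ler_pdivlMr//.
  by apply: le_trans; rewrite le_eqVlt; apply/orP; left; apply/eqP; field; lra.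
have := le_mean (fun s => aux2 (S k s)).
rewrite meanB !meanZ mean_S2// => h.
have h4 := mean_S4 (leqnn k).
rewrite mulrC -ler_pdivrMr//; apply: le_trans h.
rewrite (@le_trans _ _ (q^-1 * Q k - (6 * q ^+ 3)^-1 * (3 * Q k ^+ 2)))//.
  by rewrite -qQ le_eqVlt; apply/orP; left; apply/eqP; field; lra.
by rewrite lerD2l lerN2 ler_wpM2l// invr_ge0 mulr_ge0// exprn_ge0// ltW.
Qed.

Lemma ler_sum_norm_sqrt :
  \sum_i `|c i| <= Num.sqrt k%:R * Num.sqrt (\sum_i c i ^+ 2).
Proof.
set q := Num.sqrt (\sum_i _).
have Q0 : 0 <= \sum_i c i ^+ 2 by apply: sumr_ge0 => i _; exact: sqr_ge0.
have qQ : q ^+ 2 = \sum_i c i ^+ 2 by rewrite sqr_sqrtr.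
have [q0|q0] := eqVneq q 0.
  rewrite q0 mulr0 big1// => i _; apply/eqP; rewrite normr_eq0 -sqrf_eq0.
  move: qQ; rewrite q0 expr0n /= => /esym/eqP.
  rewrite psumr_eq0 => [/allP/(_ i)|j _]; last exact: sqr_ge0.
  by apply; rewrite mem_index_enum.
have {q0} q0 : 0 < q by rewrite lt_neqAle eq_sym q0 sqrtr_ge0.
case: (posnP k) => [k0|k0].
  rewrite big1 ?mulr_ge0 ?sqrtr_ge0// => i _.
  by have := ltn_ord i; rewrite {2}k0.
set d := Num.sqrt k%:R.
have d2 : d ^+ 2 = k%:R by rewrite sqr_sqrtr.
have d0 : 0 < d by rewrite sqrtr_gt0 ltr0n.
apply: (@le_trans _ _ (\sum_(i < k) (q / (2 * d) + d / (2 * q) * c i ^+ 2))).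
  apply: ler_sum => i _.
  rewrite -subr_ge0 (_ : _ - _ = (q - d * `|c i|) ^+ 2 / (2 * q * d)).
    by rewrite divr_ge0 ?sqr_ge0// !mulr_ge0// ltW.
  rewrite -[c i ^+ 2]real_normK ?num_real//; field; lra.
rewrite big_split /= sumr_const card_ord -mulr_sumr -qQ -[_ *+ k]mulr_natr -d2.
by rewrite le_eqVlt; apply/orP; left; apply/eqP; field; lra.
Qed.

(** By the inequality of Cauchy and Schwarz the l_2 norm in Khinchine's inequality
may be replaced by the l_1 norm, at the cost of the factor sqrt k. *)
Lemma khinchine_l1 : \sum_i `|c i| <=
  2 * Num.sqrt k%:R * mean (fun s => `|\sum_i c i * rademacher s i|).
Proof.
apply: le_trans ler_sum_norm_sqrt _.
by rewrite mulrAC mulrC ler_wpM2r ?sqrtr_ge0// khinchine.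
Qed.

(** A coefficient is the mean of the sum against its own sign. *)
Lemma le_mean_coef i : `|c i| <= mean (fun s => `|\sum_i c i * rademacher s i|).
Proof.
have -> : c i = mean (fun s => (\sum_j c j * rademacher s j) * rademacher s i).
  under eq_mean do rewrite mulr_suml.
  rewrite mean_sum (bigD1 i)//= big1 => [|j ji]; last first.
    under eq_mean do rewrite -mulrA.
    by rewrite meanZ mean_rademacher (negPf ji) mulr0.
  under eq_mean do rewrite -mulrA.
  by rewrite meanZ mean_rademacher eqxx mulr1 addr0.
apply: (le_trans (ler_norm_mean _)); apply: le_mean => s.
by rewrite normrM rademacher_norm mulr1.
Qed.

End Rademacher.

(** The functions s |-> [rademacher s n] are orthonormal; the inequality says that
the distance of X to their span is nonnegative. *)
Lemma bessel (R : realType) k (X : {ffun 'I_k -> bool} -> R) :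
  \sum_n (mean (fun s => X s * rademacher R s n)) ^+ 2 <= mean (fun s => X s ^+ 2).
Proof.
pose c n := mean (fun s => X s * rademacher R s n); rewrite -/c.
pose Y s := \sum_n c n * rademacher R s n.
have : 0 <= mean (fun s => (X s - Y s) ^+ 2).
  by rewrite -(mean_cst k (0 : R)); apply: le_mean => s; exact: sqr_ge0.
have XY : mean (fun s => X s * Y s) = \sum_n c n ^+ 2.
  under eq_mean do rewrite mulr_sumr.
  rewrite mean_sum; apply: eq_bigr => n _.
  under eq_mean do rewrite mulrCA.
  by rewrite meanZ expr2.
have YY : mean (fun s => Y s * Y s) = \sum_n c n ^+ 2.
  under eq_mean do rewrite mulr_suml.
  rewrite mean_sum; apply: eq_bigr => n _.
  under eq_mean do rewrite -mulrA.
  rewrite meanZ expr2; congr (_ * _).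
  under eq_mean do rewrite mulr_sumr.
  rewrite mean_sum (bigD1 n)//= big1 => [|j jn].
    under eq_mean do rewrite mulrCA.
    by rewrite meanZ mean_rademacher eqxx mulr1 addr0.
  under eq_mean do rewrite mulrCA.
  by rewrite meanZ mean_rademacher eq_sym (negPf jn) mulr0.
rewrite (eq_mean (Y := fun s => X s ^+ 2 - 2 * (X s * Y s) + Y s * Y s)).
  by rewrite meanD meanB meanZ XY YY; lra.
by move=> s; ring.
Qed.

Lemma sum_norm_prod_le (R : realType) k (u v : 'I_k -> R) (A B : R) :
  0 <= A -> 0 <= B -> \sum_n u n ^+ 2 <= A ^+ 2 -> \sum_n v n ^+ 2 <= B ^+ 2 ->
  \sum_n `|u n * v n| <= A * B.
Proof.
move=> A0 B0 uA vB.
have zero (w : 'I_k -> R) (D : R) : \sum_n w n ^+ 2 <= D ^+ 2 -> D = 0 ->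
    forall n, w n = 0.
  move=> + D0 n; rewrite D0 expr0n /= => w0; apply/eqP; rewrite -sqrf_eq0.
  have := psumr_eq0P (P := xpredT) (fun i _ => sqr_ge0 (w i)).
  have w0' : \sum_i w i ^+ 2 = 0.
    by apply/eqP; rewrite eq_le w0 sumr_ge0// => i _; exact: sqr_ge0.
  by move=> /(_ w0' n isT) ->.
have [A00|An0] := eqVneq A 0.
  by rewrite A00 mul0r big1// => n _; rewrite (zero u A)// mul0r normr0.
have [B00|Bn0] := eqVneq B 0.
  by rewrite B00 mulr0 big1// => n _; rewrite (zero v B)// mulr0 normr0.
have {An0} A1 : 0 < A by rewrite lt_neqAle eq_sym An0.
have {Bn0} B1 : 0 < B by rewrite lt_neqAle eq_sym Bn0.
apply: (@le_trans _ _ (\sum_n (B / (2 * A) * u n ^+ 2 + A / (2 * B) * v n ^+ 2))).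
  apply: ler_sum => n _; rewrite normrM -subr_ge0.
  rewrite -[u n ^+ 2]real_normK ?num_real// -[v n ^+ 2]real_normK ?num_real//.
  rewrite (_ : _ - _ = (B * `|u n| - A * `|v n|) ^+ 2 / (2 * A * B)).
    by rewrite divr_ge0 ?sqr_ge0// !mulr_ge0.
  field; lra.
rewrite big_split /= -!mulr_sumr.
apply: (@le_trans _ _ (B / (2 * A) * A ^+ 2 + A / (2 * B) * B ^+ 2)).
  by rewrite lerD// ler_wpM2l// divr_ge0// mulr_ge0.
by rewrite le_eqVlt; apply/orP; left; apply/eqP; field; lra.
Qed.

Lemma sum_disjoint_blocks (R : realType) k (P : nat -> nat) (x : 'I_k -> R) (i : nat) :
  {homo P : m n / (m <= n)%N} -> (forall m, `|x m| <= 1) ->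
  \sum_(m < k) `|if (P m <= i < P m.+1)%N then x m else 0| <= 1.
Proof.
move=> Pmono x1.
have [[m /andP[Pm Pm1]]|none] :=
    pselect (exists m : 'I_k, (P m <= i < P m.+1)%N); last first.
  rewrite big1 ?ler01// => m _; case: ifPn; rewrite ?normr0// => blk.
  by case: none; exists m.
rewrite (bigD1 m)//= big1 ?addr0 => [|n nm]; first by rewrite Pm Pm1 x1.
rewrite ifF ?normr0//; apply/negbTE/negP => /andP[Pn Pn1].
move: nm; rewrite -val_eqE neq_ltn => /orP[] /Pmono /= h.
  by move: (leq_trans Pn1 (leq_trans h Pm)); rewrite ltnn.
by move: (leq_trans Pm1 (leq_trans h Pn)); rewrite ltnn.
Qed.

(** By the first hypothesis all signed sums of the vectors x m are admissible. Two
independent choices of signs are averaged. For the signs s of the matrices,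
Jensen's inequality recovers the single matrix h m from the signed sum
([le_mean_coef]); this takes care of the values of the other matrices h n on x m,
which may be large. For the signs t of the vectors, Khinchine's inequality for each
column gives the sum over m of the absolute values. *)
Lemma disjoint_rows (R : realType) k L (h : 'I_k -> nat -> nat -> R)
    (x : 'I_k -> nat -> R) C :
  (forall i, \sum_m `|x m i| <= 1) ->
  (forall s u v, (forall i : nat, `|u i| <= 1) -> (forall j : nat, `|v j| <= 1) ->
    \sum_(i < L) \sum_(j < L) (\sum_n h n i j * rademacher R s n) * u i * v j <= C) ->
  \sum_m \sum_(j < L) `|\sum_(i < L) h m i j * x m i| <= 2 * Num.sqrt k%:R * C.
Proof.
move=> x1 hC.
pose c s (j : 'I_L) m := \sum_n (\sum_(i < L) h n i j * x m i) * rademacher R s n.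
have bound s t : \sum_j `|\sum_m c s j m * rademacher R t m| <= C.
  pose u i := \sum_m x m i * rademacher R t m.
  pose w (j : nat) := \sum_(i < L) (\sum_n h n i j * rademacher R s n) * u i.
  have cw (j : 'I_L) : \sum_m c s j m * rademacher R t m = w j.
    rewrite /w /u /c; under eq_bigr do rewrite mulr_suml.
    under [RHS]eq_bigr do rewrite mulr_suml.
    rewrite exchange_big [RHS]exchange_big /=; apply: eq_bigr => n _.
    under eq_bigr do rewrite !mulr_suml.
    under [RHS]eq_bigr do rewrite mulr_sumr.
    rewrite exchange_big /=; apply: eq_bigr => i _; apply: eq_bigr => m _; ring.
  under eq_bigr do rewrite cw.
  have u1 i : `|u i| <= 1.
    apply: le_trans (x1 i); apply: le_trans (ler_norm_sum _ _ _) _.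
    by apply: ler_sum => m _; rewrite normrM rademacher_norm mulr1.
  have v1 j : `|Num.sg (w j)| <= 1 by rewrite normr_sg; case: (_ != _).
  apply: le_trans (hC s u (fun j => Num.sg (w j)) u1 v1).
  rewrite exchange_big le_eqVlt /=; apply/orP; left; apply/eqP.
  by apply: eq_bigr => j _; rewrite -mulr_suml normrEsg mulrC.
have step m (j : 'I_L) :
    `|\sum_(i < L) h m i j * x m i| <= mean (fun s => `|c s j m|).
  exact: (le_mean_coef (fun n => \sum_(i < L) h n i j * x m i)).
apply: (@le_trans _ _ (mean (fun s => \sum_j \sum_m `|c s j m|))).
  rewrite mean_sum exchange_big; apply: ler_sum => j _.
  by rewrite mean_sum; apply: ler_sum => m _; exact: step.
apply: mean_le => s.
apply: (@le_trans _ _ (\sum_j (2 * Num.sqrt k%:R *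
    mean (fun t => `|\sum_m c s j m * rademacher R t m|)))).
  by apply: ler_sum => j _; exact: khinchine_l1.
rewrite -mulr_sumr -mean_sum ler_wpM2l ?mulr_ge0 ?sqrtr_ge0//.
exact: mean_le.
Qed.

(** * Signed sums of differences of matrices *)

(** Rounding the P * P entries of the corner to multiples of eta leaves finitely many
possibilities, so two of the infinitely many matrices are rounded to the same
corner. *)
Lemma pigeonhole_corner (R : realType) (A : nat -> nat -> nat -> R) (B : R) P (eta : R) :
  0 < eta -> (forall t i j, `|A t i j| <= B) ->
  exists t t', t != t' /\
    forall i j, (i < P)%N -> (j < P)%N -> `|A t i j - A t' i j| <= eta.
Proof.
move=> eta0 AB.
pose tr t i j := Num.truncn ((A t i j + B) / eta).
have pos t i j : 0 <= (A t i j + B) / eta.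
  by rewrite divr_ge0 ?(ltW eta0)//; have := AB t i j; rewrite ler_norml; lra.
pose M := Num.truncn ((B + B) / eta).
have trM t i j : (tr t i j < M.+1)%N.
  rewrite ltnS truncn_le_nat.
  apply: le_lt_trans (truncnS_gt ((B + B) / eta)).
  rewrite ler_pM2r ?invr_gt0// lerD2r.
  by have := AB t i j; rewrite ler_norml => /andP[].
pose code (t : nat) : {ffun 'I_P * 'I_P -> 'I_M.+1} :=
  [ffun ij : 'I_P * 'I_P => Ordinal (trM t ij.1 ij.2)].
have /injectivePn [t [t' tt' ctt']] : ~~ injectiveb
    (fun t : 'I_(#|{: {ffun 'I_P * 'I_P -> 'I_M.+1}}|.+1) => code t).
  by apply/injectiveP => /leq_card; rewrite card_ord ltnn.
exists (t : nat), (t' : nat); split => // i j iP jP.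
have := congr1 (fun f : {ffun _} => f (Ordinal iP, Ordinal jP)) ctt'.
rewrite !ffunE => /(congr1 val) /= h.
have /andP[l1 g1] := truncn_itv (pos t i j).
have /andP[l2 g2] := truncn_itv (pos t' i j).
move: l1 g1; rewrite -/(tr t i j) h => l1 g1.
move: l1 l2 g1 g2; rewrite -/(tr t' i j) ler_pdivlMr// ler_pdivlMr//.
rewrite ltr_pdivrMr// ltr_pdivrMr// -natr1 mulrDl mul1r ler_norml.
set z := _%:R * eta; lra.
Qed.

(** For n < k, [A n] is a sequence of matrices, any two of which are at a distance
at least delta as bilinear forms on c_0; choosing a difference of two terms in each
of the k sequences, with any signs, gives a form of norm at most C. The result is
that C is at least of the order of delta times the square root of k. *)
Section SignedFamilies.
Variables (R : realType) (k : nat) (A : 'I_k -> nat -> nat -> nat -> R).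
Variables (B C delta : R).
Hypothesis delta0 : 0 < delta.
Hypothesis A_bounded : forall n t i j, `|A n t i j| <= B.
Hypothesis A_separated : forall n t t', t != t' -> exists N N' (x y : nat -> R),
  [/\ forall i, `|x i| <= 1, forall j, `|y j| <= 1 &
    delta <= `|\sum_(i < N) \sum_(j < N') (A n t i j - A n t' i j) * x i * y j| ].
Hypothesis A_signs : forall (t t' : 'I_k -> nat) s L (u v : nat -> R),
  (forall i, `|u i| <= 1) -> (forall j, `|v j| <= 1) ->
  \sum_(i < L) \sum_(j < L)
    (\sum_n (A n (t n) i j - A n (t' n) i j) * rademacher R s n) * u i * v j <= C.

Lemma sum_cut N L (F : nat -> R) : (N <= L)%N ->
  \sum_(i < L) (if (i < N)%N then F i else 0) = \sum_(i < N) F i.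
Proof.
by move=> NL; rewrite (big_ord_widen L F NL) [RHS]big_mkcond.
Qed.

(** A pair t, t' is chosen for which the difference D of the matrices is almost 0 on the
corner [0, P) x [0, P). If x and y are vectors on which D is at least delta, then
D(x, y) splits into the value at the part of x outside [0, P), the value at the
part of y outside [0, P), and a value on the corner. *)
Lemma separated_outside_corner n P : exists (t t' N : nat) (x y : nat -> R),
  [/\ (P <= N)%N, forall i, `|x i| <= 1, forall j, `|y j| <= 1 &
   forall L, (N <= L)%N -> delta / 2 <=
    \sum_(j < L) `|\sum_(i < L) (A n t i j - A n t' i j) *
                     (if (P <= i < N)%N then x i else 0)| +
    \sum_(i < L) `|\sum_(j < L) (A n t i j - A n t' i j) *
                     (if (P <= j < N)%N then y j else 0)| ].
Proof.
(* The P * P entries of the corner contribute at most delta / 2. *)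
have eta0 : 0 < delta / (2 * P.+1%:R ^+ 2).
  by rewrite divr_gt0// mulr_gt0// exprn_gt0.
have [t [t' [tt' corner]]] := pigeonhole_corner P eta0 (A_bounded n).
have [N [N' [x [y [x1 y1 xy]]]]] := A_separated n tt'.
pose M := maxn P (maxn N N').
have PM : (P <= M)%N by exact: leq_maxl.
have NM : (N <= M)%N by rewrite /M maxnA maxnAC leq_maxr.
have NM' : (N' <= M)%N by rewrite /M maxnA leq_maxr.
pose xN i := if (i < N)%N then x i else 0.
pose yN i := if (i < N')%N then y i else 0.
have xN1 i : `|xN i| <= 1 by rewrite /xN; case: ifP; rewrite ?normr0.
have yN1 i : `|yN i| <= 1 by rewrite /yN; case: ifP; rewrite ?normr0.
exists t, t', M, xN, yN; split=> // L ML.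
pose D i j := A n t i j - A n t' i j; rewrite -/D.
pose x' i := if (P <= i < M)%N then xN i else 0; rewrite -/x'.
pose y' i := if (P <= i < M)%N then yN i else 0; rewrite -/y'.
pose xP i := if (i < P)%N then xN i else 0.
pose yP i := if (i < P)%N then yN i else 0.
have xE i : xN i = xP i + x' i.
  rewrite /xP /x' [(P <= i)%N]leqNgt; case: ltnP => /= iP; first by rewrite addr0.
  rewrite add0r /xN; case: ifPn => [|_]; last by rewrite if_same.
  by move=> /leq_trans /(_ NM) ->.
have yE i : yN i = yP i + y' i.
  rewrite /yP /y' [(P <= i)%N]leqNgt; case: ltnP => /= iP; first by rewrite addr0.
  rewrite add0r /yN; case: ifPn => [|_]; last by rewrite if_same.
  by move=> /leq_trans /(_ NM') ->.
have xP1 i : `|xP i| <= 1 by rewrite /xP; case: ifP; rewrite ?normr0.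
have yP1 i : `|yP i| <= 1 by rewrite /yP; case: ifP; rewrite ?normr0.
have total : \sum_(i < N) \sum_(j < N') D i j * x i * y j =
    \sum_(j < L) (\sum_(i < L) D i j * x' i) * yN j +
    \sum_(i < L) (\sum_(j < L) D i j * y' j) * xP i +
    \sum_(i < P) \sum_(j < P) D i j * xN i * yN j.
  have -> : \sum_(i < N) \sum_(j < N') D i j * x i * y j =
            \sum_(i < L) \sum_(j < L) D i j * xN i * yN j.
    rewrite -(sum_cut (fun i => \sum_(j < N') D i j * x i * y j) (leq_trans NM ML)).
    apply: eq_bigr => i _.
    rewrite /xN; case: ifPn => _; last first.
      by rewrite big1 // => j _; rewrite mulr0 mul0r.
    rewrite -(sum_cut (fun j => D i j * x i * y j) (leq_trans NM' ML)).
    apply: eq_bigr => j _.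
    by rewrite /yN; case: ifPn => _; rewrite ?mulr0.
  have -> : \sum_(i < P) \sum_(j < P) D i j * xN i * yN j =
            \sum_(i < L) \sum_(j < L) D i j * xP i * yP j.
    rewrite -(sum_cut (fun i => \sum_(j < P) D i j * xN i * yN j) (leq_trans PM ML)).
    apply: eq_bigr => i _.
    rewrite /xP; case: ifPn => _; last first.
      by rewrite big1 // => j _; rewrite mulr0 mul0r.
    rewrite -(sum_cut (fun j => D i j * xN i * yN j) (leq_trans PM ML)).
    apply: eq_bigr => j _.
    by rewrite /yP; case: ifPn => _; rewrite ?mulr0.
  under [X in _ = X + _ + _]eq_bigr do rewrite mulr_suml.
  rewrite [X in _ = X + _ + _]exchange_big -!big_split /=.
  apply: eq_bigr => i _; rewrite mulr_suml -!big_split /=.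
  by apply: eq_bigr => j _; rewrite xE yE; ring.
have small : `|\sum_(i < P) \sum_(j < P) D i j * xN i * yN j| <= delta / 2.
  apply: (@le_trans _ _ (\sum_(i < P) \sum_(j < P) delta / (2 * P.+1%:R ^+ 2))).
    apply: le_trans (ler_norm_sum _ _ _) _; apply: ler_sum => i _.
    apply: le_trans (ler_norm_sum _ _ _) _; apply: ler_sum => j _.
    rewrite !normrM -[leRHS]mulr1 ler_pM ?mulr_ge0// -[leRHS]mulr1 ler_pM//.
    exact: corner.
  rewrite !sumr_const !card_ord -mulrnA -[_ *+ _]mulr_natr natrM -natr1.
  set p : R := P%:R; have p0 : 0 <= p by rewrite ler0n.
  rewrite invfM !mulrA -[leRHS]mulr1 -!mulrA ler_wpM2l ?(ltW delta0)//.
  rewrite ler_wpM2l ?invr_ge0// mulrC ler_pdivrMr ?exprn_gt0//; nra.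
have rows : `|\sum_(j < L) (\sum_(i < L) D i j * x' i) * yN j| <=
    \sum_(j < L) `|\sum_(i < L) D i j * x' i|.
  apply: le_trans (ler_norm_sum _ _ _) _; apply: ler_sum => j _.
  by rewrite normrM -[leRHS]mulr1 ler_pM.
have cols : `|\sum_(i < L) (\sum_(j < L) D i j * y' j) * xP i| <=
    \sum_(i < L) `|\sum_(j < L) D i j * y' j|.
  apply: le_trans (ler_norm_sum _ _ _) _; apply: ler_sum => j _.
  by rewrite normrM -[leRHS]mulr1 ler_pM.
move: xy; rewrite total => xy.
have := le_trans xy (ler_normD _ _).
have := ler_normD (\sum_(j < L) (\sum_(i < L) D i j * x' i) * yN j)
  (\sum_(i < L) (\sum_(j < L) D i j * y' j) * xP i).
lra.
Qed.

(** The corners grow: P m.+1 is the size of the finite part used at the step m, so the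
vectors found outside the successive corners have disjoint supports, and
[disjoint_rows] applies both to the matrices and to their transposes. *)
Lemma signed_family_bound : k%:R * (delta / 2) <= 4 * Num.sqrt k%:R * C.
Proof.
have [k0|k0] := posnP k.
  by rewrite [X in X%:R * _]k0 [X in Num.sqrt X%:R]k0 mul0r sqrtr0 mulr0 mul0r.
have /choice[F hF] : forall nP : 'I_k * nat,
    exists z : (nat * nat * nat) * ((nat -> R) * (nat -> R)),
    [/\ (nP.2 <= z.1.2)%N, forall i, `|z.2.1 i| <= 1, forall j, `|z.2.2 j| <= 1 &
     forall L, (z.1.2 <= L)%N -> delta / 2 <=
    \sum_(j < L) `|\sum_(i < L) (A nP.1 z.1.1.1 i j - A nP.1 z.1.1.2 i j) *
                     (if (nP.2 <= i < z.1.2)%N then z.2.1 i else 0)| +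
    \sum_(i < L) `|\sum_(j < L) (A nP.1 z.1.1.1 i j - A nP.1 z.1.1.2 i j) *
                     (if (nP.2 <= j < z.1.2)%N then z.2.2 j else 0)| ].
  move=> [n P]; have [t [t' [N [x [y h]]]]] := separated_outside_corner n P.
  by exists ((t, t', N), (x, y)).
pose ix (m : nat) : 'I_k := insubd (Ordinal k0) m.
have ixK (m : 'I_k) : ix m = m by apply: val_inj; rewrite val_insubd ltn_ord.
pose P := fix P m := if m is m'.+1 then (F (ix m', P m')).1.2 else 0%N.
pose z (m : 'I_k) := F (m, P m).
have PS (m : 'I_k) : P m.+1 = (z m).1.2 by rewrite /= ixK.
have Pmono : {homo P : m n / (m <= n)%N}.
  apply: homo_leq => [//|n m p|m]; first exact: leq_trans.
  by have [] := hF (ix m, P m).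
have hz (m : 'I_k) := hF (m, P m).
pose L := P k; pose D (m : 'I_k) i j := A m (z m).1.1.1 i j - A m (z m).1.1.2 i j.
pose x (m : 'I_k) (i : nat) := if (P m <= i < P m.+1)%N then (z m).2.1 i else 0.
pose y (m : 'I_k) (i : nat) := if (P m <= i < P m.+1)%N then (z m).2.2 i else 0.
have x1 i : \sum_m `|x m i| <= 1.
  apply: (sum_disjoint_blocks (x := fun m => (z m).2.1 i) i Pmono) => m.
  by have [] := hz m.
have y1 i : \sum_m `|y m i| <= 1.
  apply: (sum_disjoint_blocks (x := fun m => (z m).2.2 i) i Pmono) => m.
  by have [] := hz m.
have signs := A_signs (fun m => (z m).1.1.1) (fun m => (z m).1.1.2).
have rows : \sum_m \sum_(j < L) `|\sum_(i < L) D m i j * x m i| <=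
    2 * Num.sqrt k%:R * C.
  by apply: disjoint_rows x1 _ => s u v u1 v1; exact: signs.
have cols : \sum_m \sum_(i < L) `|\sum_(j < L) D m i j * y m j| <=
    2 * Num.sqrt k%:R * C.
  apply: (@disjoint_rows R k L (fun m i j => D m j i) y C y1) => s u v u1 v1.
  rewrite exchange_big; under eq_bigr do under eq_bigr do rewrite mulrAC.
  exact: signs.
apply: (@le_trans _ _ (\sum_(m < k) delta / 2)).
  by rewrite sumr_const card_ord mulr_natl.
apply: (@le_trans _ _ (\sum_m (\sum_(j < L) `|\sum_(i < L) D m i j * x m i| +
    \sum_(i < L) `|\sum_(j < L) D m i j * y m j|))).
  apply: ler_sum => m _; have [_ _ _ /(_ L)] := hz m.
  by rewrite /x /y PS; apply; rewrite -PS; exact: Pmono.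
by rewrite big_split /=; have := lerD rows cols; lra.
Qed.

End SignedFamilies.

(** * Bounded functionals on C(K) and their atoms *)

(** A functional on C(K) is represented by a map on all functions from K to R, of
which only the values at continuous functions matter. In this way products and
truncations of continuous functions are ordinary functions. *)
Record bounded_functional (R : realType) (K : topologicalType) (C : R)
    (mu : (K -> R) -> R) : Prop := BoundedFunctional {
  functionalP : forall (a : R) (f g : K -> R), continuous f -> continuous g ->
    mu (fun t => a * f t + g t) = a * mu f + mu g ;
  functional_le : forall (f : K -> R) (M : R), continuous f -> (forall t, `|f t| <= M) ->
    `|mu f| <= C * M }.

Section ContinuousClosure.
Variables (R : realType) (K : topologicalType).
Implicit Types (a : R) (f g : K -> R).

Lemma continuous_linear a f g : continuous f -> continuous g ->
  continuous (fun t => a * f t + g t).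
Proof.
by move=> cf cg t; apply: cvgD; [apply: cvgMr; exact: cf|exact: cg].
Qed.

Lemma continuous_scale a f : continuous f -> continuous (fun t => a * f t).
Proof. by move=> cf t; apply: cvgMr; exact: cf. Qed.

Lemma continuous_add f g : continuous f -> continuous g ->
  continuous (fun t => f t + g t).
Proof. by move=> cf cg t; apply: cvgD; [exact: cf|exact: cg]. Qed.

Lemma continuous_sub f g : continuous f -> continuous g ->
  continuous (fun t => f t - g t).
Proof. by move=> cf cg t; apply: cvgB; [exact: cf|exact: cg]. Qed.

Lemma continuous_mul f g : continuous f -> continuous g ->
  continuous (fun t => f t * g t).
Proof. by move=> cf cg t; apply: cvgM; [exact: cf|exact: cg]. Qed.

Lemma continuous_cst (a : R) : continuous (fun _ : K => a).
Proof. by move=> t; exact: cvg_cst. Qed.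

Lemma continuous_maxr f g : continuous f -> continuous g ->
  continuous (fun t => Num.max (f t) (g t)).
Proof. by move=> cf cg t; apply: continuous_max; [exact: cf|exact: cg]. Qed.

Lemma continuous_minr f g : continuous f -> continuous g ->
  continuous (fun t => Num.min (f t) (g t)).
Proof. by move=> cf cg t; apply: continuous_min; [exact: cf|exact: cg]. Qed.

Lemma continuous_sum I (r : seq I) (P : pred I) (f : I -> K -> R) :
  (forall i, continuous (f i)) -> continuous (fun t => \sum_(i <- r | P i) f i t).
Proof.
move=> cf; elim: r => [|i r IH].
  by under eq_fun do rewrite big_nil; exact: continuous_cst.
under eq_fun do rewrite big_cons.
by case: (P i) => //; apply: continuous_add.
Qed.

End ContinuousClosure.

Section FunctionalTheory.
Variables (R : realType) (K : topologicalType) (C : R) (mu : (K -> R) -> R).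
Hypothesis mu_bounded : bounded_functional C mu.
Implicit Types (a : R) (f g : K -> R).

Lemma functional0 : mu (fun=> 0) = 0.
Proof.
have := functionalP mu_bounded 1 (@continuous_cst R K 0) (@continuous_cst R K 0).
by rewrite mul1r addr0 mul1r => h; apply: (addrI (mu (fun=> 0))); rewrite -h addr0.
Qed.

Lemma functional_const_ge0 : 0 <= C.
Proof.
have := functional_le mu_bounded (M := 1) (@continuous_cst R K 0).
rewrite functional0 normr0 mulr1; apply=> _; exact: ler01.
Qed.

Lemma functionalD f g : continuous f -> continuous g ->
  mu (fun t => f t + g t) = mu f + mu g.
Proof.
move=> cf cg; have := functionalP mu_bounded 1 cf cg; rewrite mul1r => <-.
by congr mu; apply/funext => t; rewrite mul1r.
Qed.

Lemma functionalZ a f : continuous f -> mu (fun t => a * f t) = a * mu f.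
Proof.
move=> cf; have := functionalP mu_bounded a cf (@continuous_cst R K 0).
by rewrite functional0 addr0 => <-; congr mu; apply/funext => t; rewrite addr0.
Qed.

Lemma functionalN f : continuous f -> mu (fun t => - f t) = - mu f.
Proof.
move=> cf; rewrite -mulN1r -functionalZ//.
by congr mu; apply/funext => t; rewrite mulN1r.
Qed.

Lemma functionalB f g : continuous f -> continuous g ->
  mu (fun t => f t - g t) = mu f - mu g.
Proof.
move=> cf cg; rewrite functionalD// ?functionalN// => t.
by apply: cvgN; exact: cg.
Qed.

Lemma functional_sum I (r : seq I) (P : pred I) (f : I -> K -> R) :
  (forall i, continuous (f i)) ->
  mu (fun t => \sum_(i <- r | P i) f i t) = \sum_(i <- r | P i) mu (f i).
Proof.
move=> cf; elim: r => [|i r IH].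
  rewrite big_nil -[RHS]functional0; congr mu. by apply/funext => t; rewrite big_nil.
rewrite big_cons -IH.
transitivity (mu (fun t => if P i then f i t + \sum_(j <- r | P j) f j t
                           else \sum_(j <- r | P j) f j t)).
  by congr mu; apply/funext => t; rewrite big_cons.
by case: (P i) => //; rewrite functionalD//; exact: continuous_sum.
Qed.

End FunctionalTheory.

Section Tents.
Variables (R : realType) (K : metricType R).
Implicit Types (s t : K) (r : R).

Definition tent s r t : R := Num.max 0 (1 - mdist s t / r).

Lemma continuous_mdist s : continuous (fun t => mdist s t : R).
Proof.
move=> t; apply/cvgrPdist_lt => e e0; apply/nbhs_ballP; exists e => //= t'.
rewrite ballEmdist /= => tt'; rewrite ltr_norml.
have := metric_triangle s t t'; have := metric_triangle s t' t.
rewrite [mdist t' t]metric_sym; lra.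
Qed.

Lemma continuous_tent s r : continuous (tent s r).
Proof.
apply: continuous_maxr; first exact: continuous_cst.
apply: continuous_sub; first exact: continuous_cst.
by apply: continuous_mul; [exact: continuous_mdist|exact: continuous_cst].
Qed.

Lemma tent_center s r : tent s r s = 1.
Proof. by rewrite /tent mdistxx mul0r subr0; apply/max_idPr; exact: ler01. Qed.

Lemma tent_ge0 s r t : 0 <= tent s r t.
Proof. by rewrite /tent le_max lexx. Qed.

Lemma tent_le1 s r t : 0 < r -> tent s r t <= 1.
Proof.
by move=> r0; rewrite /tent ge_max ler01 gerBl divr_ge0 ?mdist_ge0 ?ltW.
Qed.

Lemma tent_norm s r t : 0 < r -> `|tent s r t| <= 1.
Proof. by move=> r0; rewrite ger0_norm ?tent_ge0 ?tent_le1. Qed.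

Lemma tent_out s r t : 0 < r -> r <= mdist s t -> tent s r t = 0.
Proof. by move=> r0 rt; apply/max_idPl; rewrite subr_le0 ler_pdivlMr// mul1r. Qed.

Lemma tent_gt0 s r t : 0 < r -> mdist s t < r -> 0 < tent s r t.
Proof. by move=> r0 rt; rewrite /tent lt_max subr_gt0 ltr_pdivrMr// mul1r rt orbT. Qed.

End Tents.

Section Atoms.
Variables (R : realType) (K : metricType R).
Implicit Types (s t : K) (r : R) (mu : (K -> R) -> R).

(** The variation of mu on the punctured ball of center s and radius r is at most e. *)
Definition negligible_near mu s r (e : R) := forall f : K -> R,
  continuous f -> f s = 0 -> (forall t, `|f t| <= 1) ->
  (forall t, r <= mdist s t -> f t = 0) -> `|mu f| <= e.

(** Otherwise there are, in arbitrarily small balls, functions vanishing at s on which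
mu exceeds e. Subtracting a small truncation makes such a function vanish near s, at
the cost of e / 2; repeating this in smaller and smaller balls gives functions with
disjoint supports, whose sum has norm at most 1 and a value under mu larger than C. *)
Lemma negligible_nearP C mu s e : bounded_functional C mu -> 0 < e ->
  exists2 r, 0 < r & negligible_near mu s r e.
Proof.
move=> hmu e0; apply: contrapT => noR.
have C0 := functional_const_ge0 hmu.
have bad r : 0 < r -> exists f r', [/\ continuous f, forall t, `|f t| <= 1,
    forall t, r <= mdist s t -> f t = 0,
    0 < r' <= r & (forall t, mdist s t < r' -> f t = 0) /\ e / 2 <= mu f].
  move=> r0; have : ~ negligible_near mu s r e by move=> h; apply: noR; exists r.
  move=> /existsNP[f0] /not_implyP[cf0] /not_implyP[f0s] /not_implyP[f01].
  move=> /not_implyP[f0r] /negP; rewrite -ltNge => muf0.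
  have [f [cf fs f1 fr muf]] : exists f, [/\ continuous f, f s = 0,
      forall t, `|f t| <= 1, forall t, r <= mdist s t -> f t = 0 & e < mu f].
    have [h|h] := leP 0 (mu f0).
      by exists f0; split=> //; rewrite ger0_norm in muf0.
    exists (fun t => - f0 t); split.
    - by move=> t; apply: cvgN; exact: cf0.
    - by rewrite f0s oppr0.
    - by move=> t; rewrite normrN.
    - by move=> t /f0r ->; rewrite oppr0.
    - by rewrite (functionalN hmu)// -ltr0_norm.
  (* The truncation at the level eta changes mu f by at most C * eta <= e / 2. *)
  pose eta := e / (2 * (C + 1)).
  have eta0 : 0 < eta by rewrite divr_gt0// mulr_gt0// ltr_wpDl.
  pose clip t := Num.max (- eta) (Num.min eta (f t)).
  have cclip : continuous clip.
    apply: continuous_maxr; first exact: continuous_cst.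
    by apply: continuous_minr => //; exact: continuous_cst.
  have clip_small t : `|f t| <= eta -> clip t = f t.
    rewrite ler_norml => /andP[h1 h2]; rewrite /clip (min_idPr _)//.
    exact/max_idPr.
  have clip_eta t : `|clip t| <= eta.
    rewrite ler_norml /clip le_max lexx /= ge_max ge_min lexx /= andbT.
    by rewrite ge0_cp// ltW.
  have clip_sign t : `|f t - clip t| <= `|f t|.
    rewrite /clip; case: (leP eta (f t)) => h.
      rewrite (max_idPr _); last by rewrite ge0_cp// ltW.
      rewrite !ger0_norm; lra.
    case: (leP (- eta) (f t)) => h'; first by rewrite subrr normr0.
    by rewrite !ler0_norm; lra.
  have /cvgrPdist_lt/(_ _ eta0)/nbhs_ballP[r' /= r'0 hr'] := cf s.
  exists (fun t => f t - clip t), (Num.min r r'); split.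
  - exact: continuous_sub.
  - by move=> t; apply: le_trans (clip_sign t) (f1 t).
  - by move=> t /fr ft; rewrite ft clip_small ?ft ?normr0 ?subrr// ltW.
  - by rewrite lt_min r0 r'0 ge_min lexx.
  split.
    move=> t; rewrite lt_min => /andP[_ tr']; rewrite clip_small ?subrr// ltW//.
    by have := hr' t; rewrite ballEmdist /= fs sub0r normrN; apply.
  rewrite (functionalB hmu)//.
  have := functional_le hmu cclip clip_eta; rewrite ler_norml => /andP[_ h].
  have : C * eta <= e / 2.
    rewrite /eta mulrA ler_pdivrMr; last by rewrite mulr_gt0// ltr_wpDl.
    rewrite (_ : e / 2 * (2 * (C + 1)) = C * e + e); last by field.
    by rewrite lerDl ltW.
  by lra.
have grow (N : nat) : forall r, 0 < r -> exists f, [/\ continuous f,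
    forall t, `|f t| <= 1, forall t, r <= mdist s t -> f t = 0 & N%:R * (e / 2) <= mu f].
  elim: N => [|N IH] r r0.
    exists (fun=> 0); split=> //; first exact: continuous_cst.
      by move=> t; rewrite normr0.
    by rewrite mul0r (functional0 hmu).
  have [f [r' [cf f1 fr /andP[r'0 r'r] [fr' muf]]]] := bad r r0.
  have [g [cg g1 gr mug]] := IH r' r'0.
  exists (fun t => f t + g t); split.
  - exact: continuous_add.
  - move=> t; have [h|h] := ltP (mdist s t) r'; first by rewrite fr'// add0r.
    by rewrite gr// addr0.
  - by move=> t rt; rewrite fr// gr ?addr0// (le_trans r'r).
  - by rewrite (functionalD hmu)// -natr1 mulrDl mul1r addrC lerD.
(* With N functions of this kind the value N * (e / 2) exceeds C. *)
pose N := (Num.truncn (C / (e / 2))).+1.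
have [f [cf f1 _ muf]] := grow N 1 ltr01.
have := functional_le hmu cf f1; rewrite mulr1 ler_norml => /andP[_ muC].
have := truncnS_gt (C / (e / 2)); rewrite ltr_pdivrMr ?divr_gt0// -/N => h.
by have := lt_le_trans h (le_trans muf muC); rewrite ltxx.
Qed.

(** The mass of the point s for the measure represented by mu. *)
Definition atom mu s : R := lim (mu (tent s n.+1%:R^-1) @[n --> \oo]).

Lemma tent_close mu s r e r1 r2 C : bounded_functional C mu ->
  negligible_near mu s r e -> 0 < r1 <= r -> 0 < r2 <= r ->
  `|mu (tent s r1) - mu (tent s r2)| <= e.
Proof.
move=> hmu hr /andP[r10 r1r] /andP[r20 r2r].
rewrite -(functionalB hmu); try exact: continuous_tent.
apply: hr.
- by apply: continuous_sub; exact: continuous_tent.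
- by rewrite !tent_center subrr.
- move=> t; have := tent_ge0 s r1 t; have := tent_ge0 s r2 t.
  have := tent_le1 s t r10; have := tent_le1 s t r20.
  by rewrite ler_norml; lra.
- by move=> t rt; rewrite !tent_out ?subrr// (le_trans _ rt).
Qed.

Lemma small_invn (r : R) : 0 < r -> \forall n \near \oo, n.+1%:R^-1 <= r.
Proof.
by move=> r0; apply: filterS (near_infty_natSinv_lt (PosNum r0)) => n /ltW.
Qed.

Lemma atom_cvg C mu s : bounded_functional C mu ->
  mu (tent s n.+1%:R^-1) @[n --> \oo] --> atom mu s.
Proof.
move=> hmu; suff : cvg (mu (tent s n.+1%:R^-1) @[n --> \oo]) by [].
apply/cauchy_cvgP/cauchyP => e e0; have e20 : 0 < e / 2 by rewrite divr_gt0.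
have [r r0 hr] := negligible_nearP s hmu e20.
have [N _ hN] := small_invn r0.
exists (mu (tent s N.+1%:R^-1)); exists N => // n /= Nn.
rewrite -ball_normE /=; apply: (@le_lt_trans _ _ (e / 2)); last lra.
by apply: tent_close hmu hr _ _; rewrite invr_gt0 ltr0n /= hN//=.
Qed.

Lemma tent_atom C mu s r e r1 : bounded_functional C mu ->
  negligible_near mu s r e -> 0 < r1 <= r -> `|mu (tent s r1) - atom mu s| <= e.
Proof.
move=> hmu hr r1r.
have cv : `|mu (tent s r1) - mu (tent s n.+1%:R^-1)| @[n --> \oo] -->
    `|mu (tent s r1) - atom mu s|.
  by apply: cvg_norm; apply: cvgB; [exact: cvg_cst|exact: atom_cvg hmu].
rewrite -(cvg_lim _ cv)//; apply: limr_le; first by apply/cvg_ex; eexists; exact: cv.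
have r0 : 0 < r by case/andP: r1r; exact: lt_le_trans.
apply: filterS (small_invn r0) => n nr.
by apply: tent_close hmu hr _ _ => //; rewrite invr_gt0 ltr0n.
Qed.

Lemma atomP C D mu nu a s : bounded_functional C mu -> bounded_functional D nu ->
  atom (fun f => a * mu f + nu f) s = a * atom mu s + atom nu s.
Proof.
move=> hmu hnu; have h : (fun n => a * mu (tent s n.+1%:R^-1)
    + nu (tent s n.+1%:R^-1)) @ \oo --> a * atom mu s + atom nu s.
  apply: cvgD; last exact: atom_cvg hnu.
  by apply: cvgMr; exact: atom_cvg hmu.
exact: cvg_lim h.
Qed.

Lemma eq_atom mu nu s : (forall f, continuous f -> mu f = nu f) ->
  atom mu s = atom nu s.
Proof.
move=> h; rewrite /atom; suff -> : (fun n => mu (tent s n.+1%:R^-1)) =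
  (fun n => nu (tent s n.+1%:R^-1)) by [].
by apply/funext => n; apply: h; exact: continuous_tent.
Qed.

End Atoms.

(** * The atoms determine the functional when K is countable *)

Lemma positive_lower_bound (R : realType) (I : finType) (f : I -> R) :
  (forall i, 0 < f i) -> exists2 r, 0 < r & forall i, r <= f i.
Proof.
move=> f0; have S0 : 0 <= \sum_i (f i)^-1.
  by apply: sumr_ge0 => i _; rewrite invr_ge0 ltW.
have S1 : 0 < 1 + \sum_i (f i)^-1 by rewrite ltr_pwDl.
exists (1 + \sum_i (f i)^-1)^-1; first by rewrite invr_gt0.
move=> i; rewrite -[leRHS]invrK lef_pV2 ?posrE ?invr_gt0//.
rewrite (bigD1 i)//= addrCA lerDl addr_ge0// sumr_ge0// => j _.
by rewrite invr_ge0 ltW.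
Qed.

Lemma sum_half_powers (R : realType) N : \sum_(i < N) (2^-1 : R) ^+ i.+1 <= 1.
Proof.
suff -> : \sum_(i < N) (2^-1 : R) ^+ i.+1 = 1 - 2^-1 ^+ N.
  by rewrite gerBl exprn_ge0// invr_ge0.
elim: N => [|N IH]; first by rewrite big_ord0 expr0 subrr.
by rewrite big_ord_recr /= IH exprS; lra.
Qed.

Section CountableCompact.
Variables (R : realType) (K : metricType R) (e : nat -> K).
Hypotheses (cK : compact [set: K]) (e_inj : injective e).
Hypothesis e_surj : forall t, exists i, e i = t.

(** A radius for which the tents around the first N points have disjoint supports, and
which is smaller than N prescribed radii. *)
Lemma separation_radius N (r : nat -> R) : (forall i, 0 < r i) ->
  exists2 rho, 0 < rho &
    (forall i, (i < N)%N -> rho <= r i) /\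
    (forall i j, (i < N)%N -> (j < N)%N -> i != j ->
       rho + rho <= mdist (e i) (e j)).
Proof.
move=> r0.
have [r1 r10 hr1] := positive_lower_bound (fun i : 'I_N => r0 i).
have [|r2 r20 hr2] := positive_lower_bound (I := ('I_N * 'I_N)%type)
    (f := fun ij => if ij.1 == ij.2 then 1 else mdist (e ij.1) (e ij.2) / 2).
  move=> [i j] /=; case: eqVneq => // ij; rewrite divr_gt0// mdist_gt0.
  by rewrite (inj_eq e_inj).
exists (Num.min r1 r2); first by rewrite lt_min r10.
split=> [i iN|i j iN jN ij]; first by rewrite ge_min (hr1 (Ordinal iN)).
have := hr2 (Ordinal iN, Ordinal jN); rewrite -val_eqE /= (negPf ij) => h.
have : Num.min r1 r2 <= r2 by rewrite ge_min lexx orbT.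
lra.
Qed.

Lemma sum_tents_le1 N rho t (x : nat -> R) : 0 < rho ->
  (forall i j, (i < N)%N -> (j < N)%N -> i != j -> rho + rho <= mdist (e i) (e j)) ->
  (forall i, `|x i| <= 1) -> `|\sum_(i < N) x i * tent (e i) rho t| <= 1.
Proof.
move=> rho0 sep x1.
have [[i ti]|none] := pselect (exists i : 'I_N, mdist (e i) t < rho); last first.
  rewrite big1 ?normr0// => i _; rewrite tent_out ?mulr0// leNgt.
  by apply/negP => h; apply: none; exists i.
rewrite (bigD1 i)//= big1 ?addr0 => [|j ji].
  by rewrite normrM -[leRHS]mulr1 ler_pM// tent_norm.
rewrite tent_out ?mulr0//; have := sep i j (ltn_ord i) (ltn_ord j).
rewrite eq_sym => /(_ ji); have := metric_triangle (e i) t (e j).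
rewrite [mdist t _]metric_sym; move: ti; lra.
Qed.

(** The sequence of the atoms has l_1 norm at most C: the vector x is interpolated by
tents with disjoint supports, which are so narrow that mu sees only the atoms. *)
Lemma atoms_le C mu N (x : nat -> R) : bounded_functional C mu ->
  (forall i, `|x i| <= 1) -> `|\sum_(i < N) x i * atom mu (e i)| <= C.
Proof.
move=> hmu x1; apply/ler_addgt0Pl => eps eps0.
have d0 : 0 < eps / N.+1%:R by rewrite divr_gt0.
have /choice[r hr] i : exists r, 0 < r /\ negligible_near mu (e i) r (eps / N.+1%:R).
  by have [r r0 h] := negligible_nearP (e i) hmu d0; exists r.
have [rho rho0 [rhor sep]] := separation_radius N (fun i => (hr i).1).
pose f t := \sum_(i < N) x i * tent (e i) rho t.
have cf i : continuous (fun t => x i * tent (e i) rho t).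
  by apply: continuous_scale; exact: continuous_tent.
have muf : mu f = \sum_(i < N) x i * mu (tent (e i) rho).
  rewrite (functional_sum hmu)//; apply: eq_bigr => i _.
  by rewrite (functionalZ hmu)//; exact: continuous_tent.
have fC : `|mu f| <= C.
  rewrite -[leRHS]mulr1; apply: (functional_le hmu).
    by apply: continuous_sum.
  by move=> t; exact: sum_tents_le1.
have -> : \sum_(i < N) x i * atom mu (e i) =
    \sum_(i < N) x i * (atom mu (e i) - mu (tent (e i) rho)) + mu f.
  by rewrite muf -big_split; apply: eq_bigr => i _ /=; rewrite -mulrDr subrK.
apply: le_trans (ler_normD _ _) _; rewrite lerD//.
apply: (@le_trans _ _ (\sum_(i < N) eps / N.+1%:R)).
  apply: le_trans (ler_norm_sum _ _ _) _; apply: ler_sum => i _.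
  rewrite normrM -[leRHS]mul1r ler_pM// distrC.
  by apply: tent_atom hmu (hr i).2 _; rewrite rho0 rhor.
rewrite sumr_const card_ord -[_ *+ N]mulr_natr mulrAC ler_pdivrMr//.
by rewrite ler_wpM2l ?(ltW eps0)// ler_nat.
Qed.

Lemma balls_cover (r : nat -> R) : (forall i, 0 < r i) ->
  exists N, forall t, exists2 i : 'I_N, true & mdist (e i) t < r i.
Proof.
move=> r0; have /compact_near_coveringP cover := cK.
have [] := cover nat \oo (fun N t => exists2 i : 'I_N, true & mdist (e i) t < r i).
  move=> t _; have [i it] := e_surj t.
  exists (ball t (r i), [set n | i < n]%N) => /=.
    by split; [exact: nbhsx_ballx|exists i.+1].
  move=> [t' n] /= [tt' ni]; exists (Ordinal ni) => //=.
  by move: tt'; rewrite ballEmdist /= it.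
by move=> N _ hN; exists N => t; apply: (hN N) => /=.
Qed.

(** K is covered by finitely many balls around the e i, on each of which the
variation of mu outside of the center is tiny. Replacing x by its interpolation f
with tents leaves a function vanishing at the centers, which a partition of unity
distributes over the balls. *)
Lemma atoms_approx C mu x eps : bounded_functional C mu ->
  continuous x -> (forall t, `|x t| <= 1) -> 0 < eps ->
  exists N, `|mu x - \sum_(i < N) x (e i) * atom mu (e i)| <= eps.
Proof.
move=> hmu cx x1 eps0.
(* The error at e i is charged three times: once for its atom, and twice for the
   remainder, whose norm is at most 2. *)
pose d i : R := eps / 3 * 2^-1 ^+ i.+1.
have d0 i : 0 < d i by rewrite mulr_gt0 ?divr_gt0// exprn_gt0// invr_gt0.
have /choice[r hr] i : exists r, 0 < r /\ negligible_near mu (e i) r (d i).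
  by have [r r0 h] := negligible_nearP (e i) hmu (d0 i); exists r.
have r0 i := (hr i).1.
have [N cover] := balls_cover r0; exists N.
have [rho rho0 [rhor sep]] := separation_radius N r0.
pose f t := \sum_(i < N) x (e i) * tent (e i) rho t.
have cfi i : continuous (fun t => x (e i) * tent (e i) rho t).
  by apply: continuous_scale; exact: continuous_tent.
have cf : continuous f by exact: continuous_sum.
have muf : mu f = \sum_(i < N) x (e i) * mu (tent (e i) rho).
  rewrite (functional_sum hmu)//; apply: eq_bigr => i _.
  by rewrite (functionalZ hmu)//; exact: continuous_tent.
have fe (i : 'I_N) : f (e i) = x (e i).
  rewrite /f (bigD1 i)//= tent_center mulr1 big1 ?addr0// => j ji.
  rewrite tent_out ?mulr0//; have := sep j i (ltn_ord j) (ltn_ord i) ji.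
  lra.
pose W t := \sum_(i < N) tent (e i) (r i) t.
have W0 t : 0 < W t.
  have [i _ ti] := cover t; rewrite /W (bigD1 i)//= ltr_pwDl ?tent_gt0//.
  by apply: sumr_ge0 => j _; exact: tent_ge0.
have cW : continuous (fun t => (W t)^-1).
  move=> t; apply: cvgV; first by rewrite gt_eqF.
  by apply: continuous_sum => i; exact: continuous_tent.
pose g i t := 2^-1 * (x t - f t) * (tent (e i) (r i) t / W t).
have cg i : continuous (g i).
  apply: continuous_mul; last by apply: continuous_mul => //; exact: continuous_tent.
  by apply: continuous_scale; exact: continuous_sub.
have gE t : x t - f t = 2 * \sum_(i < N) g i t.
  rewrite /g -mulr_sumr -mulr_suml -/(W t) divff ?gt_eqF// mulr1 mulrA.
  by rewrite divff// mul1r.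
have mug (i : 'I_N) : `|mu (g i)| <= d i.
  apply: (hr i).2 => //.
  - by rewrite /g fe subrr mulr0 mul0r.
  - move=> t; rewrite /g normrM -[leRHS]mulr1 ler_pM//.
      rewrite normrM ger0_norm ?invr_ge0// ler_pdivrMl// mulr1.
      apply: le_trans (ler_normB _ _) _.
      have : `|f t| <= 1 by apply: (@sum_tents_le1 N rho t (x \o e)) => //= i'.
      by have := x1 t; lra.
    rewrite ger0_norm; last by rewrite divr_ge0 ?tent_ge0// ltW.
    rewrite ler_pdivrMr// mul1r /W (bigD1 i)//= lerDl.
    by apply: sumr_ge0 => j _; exact: tent_ge0.
  - by move=> t rt; rewrite /g tent_out// mul0r mulr0.
have -> : mu x - \sum_(i < N) x (e i) * atom mu (e i) =
   2 * \sum_(i < N) mu (g i) +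
   \sum_(i < N) x (e i) * (mu (tent (e i) rho) - atom mu (e i)).
  under [X in _ = _ + X]eq_bigr do rewrite mulrBr.
  rewrite sumrB -muf -(functional_sum hmu)// -(functionalZ hmu); last first.
    exact: continuous_sum.
  rewrite addrA; congr (_ - _); apply/eqP; rewrite -subr_eq; apply/eqP.
  by rewrite -(functionalB hmu)//; congr mu; apply/funext => t.
apply: (@le_trans _ _ (3 * \sum_(i < N) d i)); last first.
  rewrite /d -mulr_sumr; have := sum_half_powers R N.
  by set S := \sum_(i < N) _ => S1; nra.
have h1 : `|\sum_(i < N) mu (g i)| <= \sum_(i < N) d i.
  by apply: le_trans (ler_norm_sum _ _ _) _; apply: ler_sum.
have h2 : `|\sum_(i < N) x (e i) * (mu (tent (e i) rho) - atom mu (e i))| <=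
    \sum_(i < N) d i.
  apply: le_trans (ler_norm_sum _ _ _) _; apply: ler_sum => i _.
  rewrite normrM -[leRHS]mul1r ler_pM//.
  by apply: tent_atom hmu (hr i).2 _; rewrite rho0 rhor.
apply: le_trans (ler_normD _ _) _; rewrite normrM ger0_norm//.
lra.
Qed.

End CountableCompact.

Lemma tents_interpolate (R : realType) (K : metricType R) (e : nat -> K) N
    (x : nat -> R) : injective e -> (forall i, `|x i| <= 1) ->
  exists f : K -> R, [/\ continuous f, forall t, `|f t| <= 1 &
    forall i, (i < N)%N -> f (e i) = x i].
Proof.
move=> e_inj x1.
have [rho rho0 [_ sep]] := @separation_radius R K e e_inj N (fun=> 1) (fun=> ltr01).
exists (fun t => \sum_(i < N) x i * tent (e i) rho t); split.
- by apply: continuous_sum => i; apply: continuous_scale; exact: continuous_tent.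
- by move=> t; exact: sum_tents_le1.
- move=> i iN; rewrite (bigD1 (Ordinal iN))//= tent_center mulr1 big1 ?addr0// => j ji.
  rewrite tent_out ?mulr0//.
  have := sep j i (ltn_ord j) iN ji; lra.
Qed.

(** * The matrix of a bounded bilinear form on C(K) *)

Record bounded_bilinear (R : realType) (K : topologicalType) (C : R)
    (G : (K -> R) -> (K -> R) -> R) : Prop := BoundedBilinear {
  bilinearPl : forall (a : R) (x x' y : K -> R),
    continuous x -> continuous x' -> continuous y ->
    G (fun t => a * x t + x' t) y = a * G x y + G x' y ;
  bilinearPr : forall (a : R) (x y y' : K -> R),
    continuous x -> continuous y -> continuous y' ->
    G x (fun t => a * y t + y' t) = a * G x y + G x y' ;
  bilinear_le : forall (x y : K -> R) (M N : R), continuous x -> continuous y ->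
    (forall t, `|x t| <= M) -> (forall t, `|y t| <= N) ->
    `|G x y| <= C * M * N }.

Section Combinations.
Variables (R : realType) (K : metricType R).
Implicit Types (mu nu : (K -> R) -> R) (G H : (K -> R) -> (K -> R) -> R).

Lemma bounded_functional_cst0 : bounded_functional 0 (fun _ : K -> R => 0 : R).
Proof.
by split=> [a f g _ _|f M _ _]; rewrite ?mulr0 ?addr0// normr0 mul0r.
Qed.

Lemma bounded_functionalP a C D mu nu :
  bounded_functional C mu -> bounded_functional D nu ->
  bounded_functional (`|a| * C + D) (fun f => a * mu f + nu f).
Proof.
move=> hmu hnu; split=> [b f g cf cg|f M cf fM].
  by rewrite (functionalP hmu)// (functionalP hnu)//; ring.
apply: le_trans (ler_normD _ _) _; rewrite mulrDl lerD ?(functional_le hnu)//.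
by rewrite normrM -mulrA ler_wpM2l// (functional_le hmu).
Qed.

Lemma atom_cst0 s : atom (fun _ : K -> R => 0 : R) s = 0.
Proof. exact: lim_cst. Qed.

Lemma atom_sum I (r : seq I) (c D : I -> R) (mu : I -> (K -> R) -> R) s :
  (forall i, bounded_functional (D i) (mu i)) ->
  atom (fun f => \sum_(i <- r) c i * mu i f) s = \sum_(i <- r) c i * atom (mu i) s.
Proof.
move=> hmu; suff [_ ->//] : (exists B, bounded_functional B
  (fun f => \sum_(i <- r) c i * mu i f)) /\
  atom (fun f => \sum_(i <- r) c i * mu i f) s = \sum_(i <- r) c i * atom (mu i) s.
elim: r => [|i r [[B hB] IH]].
  have -> : (fun f : K -> R => \sum_(i <- [::]) c i * mu i f) = (fun=> 0).
    by apply/funext => f; rewrite big_nil.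
  by rewrite big_nil atom_cst0; split=> //; exists 0; exact: bounded_functional_cst0.
have -> : (fun f : K -> R => \sum_(j <- i :: r) c j * mu j f) =
    (fun f => c i * mu i f + \sum_(j <- r) c j * mu j f).
  by apply/funext => f; rewrite big_cons.
rewrite (atomP _ _ (hmu i) hB) IH big_cons; split=> //.
by eexists; apply: bounded_functionalP => //; exact: hB.
Qed.

Lemma atom_le C mu s : bounded_functional C mu -> `|atom mu s| <= C.
Proof.
move=> hmu; have cv : `|mu (tent s n.+1%:R^-1)| @[n --> \oo] --> `|atom mu s|.
  by apply: cvg_norm; exact: atom_cvg hmu.
rewrite -(cvg_lim _ cv)//; apply: limr_le; first by apply/cvg_ex; eexists; exact: cv.
near=> n; rewrite -[leRHS]mulr1; apply: (functional_le hmu).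
  exact: continuous_tent.
by move=> t; rewrite tent_norm// invr_gt0.
Unshelve. all: by end_near. Qed.

Lemma bounded_bilinear_cst0 : bounded_bilinear 0 (fun _ _ : K -> R => 0 : R).
Proof.
by split=> [a x x' y|a x y y'|x y M N] *; rewrite ?mulr0 ?addr0// normr0 !mul0r.
Qed.

Lemma bounded_bilinearP a C D G H :
  bounded_bilinear C G -> bounded_bilinear D H ->
  bounded_bilinear (`|a| * C + D) (fun x y => a * G x y + H x y).
Proof.
move=> hG hH; split=> [b x x' y cx cx' cy|b x y y' cx cy cy'|x y M N cx cy xM yN].
- by rewrite (bilinearPl hG)// (bilinearPl hH)//; ring.
- by rewrite (bilinearPr hG)// (bilinearPr hH)//; ring.
- apply: le_trans (ler_normD _ _) _; rewrite !mulrDl lerD ?(bilinear_le hH)//.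
  by rewrite normrM -!mulrA ler_wpM2l// mulrA (bilinear_le hG).
Qed.

End Combinations.

Section MatrixOfBilinearForm.
Variables (R : realType) (K : metricType R) (e : nat -> K).
Hypotheses (cK : compact [set: K]) (e_inj : injective e).
Hypothesis e_surj : forall t, exists i, e i = t.
Implicit Types (G H : (K -> R) -> (K -> R) -> R).

Lemma continuous_bounded (f : K -> R) : continuous f ->
  exists M, forall t, `|f t| <= M.
Proof.
move=> cf; have cnf : continuous (fun t => `|f t|).
  by move=> t; apply: cvg_norm; exact: cf.
have [|c _ hc] := compact_EVT_max _ cK (continuous_subspaceT cnf).
  by exists (e 0%N).
by exists `|f c| => t; apply: hc; rewrite inE.
Qed.

Lemma bilinear_section C G y N : bounded_bilinear C G -> continuous y ->
  (forall t, `|y t| <= N) -> bounded_functional (C * N) (fun x => G x y).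
Proof.
move=> hG cy yN; split=> [a f g cf cg|f M cf fM]; first exact: (bilinearPl hG).
by rewrite mulrAC; exact: (bilinear_le hG).
Qed.

Lemma bilinear_section_ex C G y : bounded_bilinear C G -> continuous y ->
  exists D, bounded_functional D (fun x => G x y).
Proof.
move=> hG cy; have [N yN] := continuous_bounded cy.
by exists (C * N); exact: bilinear_section.
Qed.

Lemma bounded_atom C G s : bounded_bilinear C G ->
  bounded_functional C (fun y => atom (fun x => G x y) s).
Proof.
move=> hG; split=> [a f g cf cg|f M cf fM]; last first.
  by apply: atom_le; exact: bilinear_section.
have [D1 h1] := bilinear_section_ex hG cf.
have [D2 h2] := bilinear_section_ex hG cg.
rewrite -(atomP _ _ h1 h2); apply: eq_atom => x cx.
exact: (bilinearPr hG).
Qed.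

(** Both variables are evaluated at atoms, the first one first. The iterated
construction defines an extension of G to functions on the discrete set K. *)
Definition bilinear_matrix G i j : R :=
  atom (fun y => atom (fun x => G x y) (e i)) (e j).

Lemma bilinear_matrix_le C G i j : bounded_bilinear C G ->
  `|bilinear_matrix G i j| <= C.
Proof. by move=> hG; apply: atom_le; exact: bounded_atom. Qed.

Lemma bilinear_matrixP a C D G H i j :
  bounded_bilinear C G -> bounded_bilinear D H ->
  bilinear_matrix (fun x y => a * G x y + H x y) i j =
  a * bilinear_matrix G i j + bilinear_matrix H i j.
Proof.
move=> hG hH; rewrite -(atomP _ _ (bounded_atom _ hG) (bounded_atom _ hH)).
apply: eq_atom => y cy.
have [D1 h1] := bilinear_section_ex hG cy.
have [D2 h2] := bilinear_section_ex hH cy.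
exact: atomP h1 h2.
Qed.

Lemma bilinear_matrix_sum I (r : seq I) (c C : I -> R)
    (G : I -> (K -> R) -> (K -> R) -> R) i j :
  (forall n, bounded_bilinear (C n) (G n)) ->
  bilinear_matrix (fun x y => \sum_(n <- r) c n * G n x y) i j =
  \sum_(n <- r) c n * bilinear_matrix (G n) i j.
Proof.
move=> hG; suff [_ ->//] : (exists B, bounded_bilinear B
  (fun x y => \sum_(n <- r) c n * G n x y)) /\
  bilinear_matrix (fun x y => \sum_(n <- r) c n * G n x y) i j =
  \sum_(n <- r) c n * bilinear_matrix (G n) i j.
elim: r => [|n r [[B hB] IH]].
  have -> : (fun x y : K -> R => \sum_(n <- [::]) c n * G n x y) = (fun _ _ => 0).
    by apply/funext => x; apply/funext => y; rewrite big_nil.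
  rewrite big_nil; split; first by exists 0; exact: bounded_bilinear_cst0.
  rewrite /bilinear_matrix -[RHS](atom_cst0 (e j)); congr (atom _ _).
  by apply/funext => y; rewrite atom_cst0.
have -> : (fun x y : K -> R => \sum_(m <- n :: r) c m * G m x y) =
    (fun x y => c n * G n x y + \sum_(m <- r) c m * G m x y).
  by apply/funext => x; apply/funext => y; rewrite big_cons.
rewrite (bilinear_matrixP _ _ _ (hG n) hB) IH big_cons; split=> //.
by eexists; apply: bounded_bilinearP => //; exact: hB.
Qed.

Section Rows.
Variables (C : R) (G : (K -> R) -> (K -> R) -> R) (N : nat) (x : nat -> R).
Hypotheses (hG : bounded_bilinear C G) (x1 : forall i, `|x i| <= 1).

Let row y := \sum_(i < N) x i * atom (fun x => G x y) (e i).

(** For a fixed vector x in the first variable, the extension is still a bounded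
functional in the second variable, so the theory of atoms applies again. *)
Lemma row_bounded : bounded_functional C row.
Proof.
split=> [a f g cf cg|f M cf fM].
  rewrite /row mulr_sumr -big_split; apply: eq_bigr => i _ /=.
  by rewrite (functionalP (bounded_atom (e i) hG))//; ring.
by apply: atoms_le => //; exact: bilinear_section.
Qed.

Lemma row_atoms N' (y : nat -> R) : \sum_(j < N') y j * atom row (e j) =
  \sum_(i < N) \sum_(j < N') bilinear_matrix G i j * x i * y j.
Proof.
rewrite exchange_big; apply: eq_bigr => j _ /=.
rewrite (atom_sum _ _ _ (fun i : 'I_N => bounded_atom (e i) hG)) mulr_sumr.
by apply: eq_bigr => i _; rewrite /bilinear_matrix; ring.
Qed.

End Rows.

Lemma bilinear_matrix_form_le C G N N' (x y : nat -> R) :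
  bounded_bilinear C G -> (forall i, `|x i| <= 1) -> (forall j, `|y j| <= 1) ->
  `|\sum_(i < N) \sum_(j < N') bilinear_matrix G i j * x i * y j| <= C.
Proof.
move=> hG x1 y1; rewrite -(row_atoms _ _ hG).
by apply: atoms_le => //; exact: row_bounded.
Qed.

Lemma bilinear_matrix_approx C G x y eps : bounded_bilinear C G ->
  continuous x -> continuous y ->
  (forall t, `|x t| <= 1) -> (forall t, `|y t| <= 1) -> 0 < eps ->
  exists N N', `|G x y -
    \sum_(i < N) \sum_(j < N') bilinear_matrix G i j * x (e i) * y (e j)| <= eps.
Proof.
move=> hG cx cy x1 y1 eps0; have e20 : 0 < eps / 2 by rewrite divr_gt0.
have [N hN] := atoms_approx cK e_inj e_surj (bilinear_section hG cy y1) cx x1 e20.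
have hrow := row_bounded N hG (x := x \o e) (fun i => x1 (e i)).
have [N' hN'] := atoms_approx cK e_inj e_surj hrow cy y1 e20.
exists N, N'; rewrite -(row_atoms _ (x \o e) hG N' (y \o e)).
rewrite [eps]splitr; apply: le_trans (lerD hN hN'); apply: le_trans (ler_normD _ _).
by rewrite addrA subrK.
Qed.

End MatrixOfBilinearForm.

Lemma bilinear_section_r (R : realType) (K : topologicalType) (C M : R)
    (G : (K -> R) -> (K -> R) -> R) x : bounded_bilinear C G -> continuous x ->
  (forall t, `|x t| <= M) -> bounded_functional (C * M) (G x).
Proof.
move=> hG cx xM; split=> [a f g cf cg|f N cf fN]; first exact: (bilinearPr hG).
exact: (bilinear_le hG).
Qed.

Lemma bilinear_ball_le (R : realType) (K : metricType R) (C D : R)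
    (G : (K -> R) -> (K -> R) -> R) : bounded_bilinear C G ->
  (forall x y, continuous x -> continuous y -> (forall t, `|x t| <= 1) ->
     (forall t, `|y t| <= 1) -> `|G x y| <= D) ->
  forall x y M N, 0 <= M -> 0 <= N -> continuous x -> continuous y ->
    (forall t, `|x t| <= M) -> (forall t, `|y t| <= N) -> `|G x y| <= D * M * N.
Proof.
move=> hG GD x y M N M0 N0 cx cy xM yN.
have [M00|Mn0] := eqVneq M 0.
  by have := bilinear_le hG cx cy xM yN; rewrite M00 !mulr0 !mul0r.
have [N00|Nn0] := eqVneq N 0.
  by have := bilinear_le hG cx cy xM yN; rewrite N00 !mulr0.
have {Mn0} M1 : 0 < M by rewrite lt_neqAle eq_sym Mn0.
have {Nn0} N1 : 0 < N by rewrite lt_neqAle eq_sym Nn0.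
have cx' := continuous_scale (a := M^-1) cx.
have cy' := continuous_scale (a := N^-1) cy.
have x'1 t : `|M^-1 * x t| <= 1.
  by rewrite normrM gtr0_norm ?invr_gt0// ler_pdivrMl// mulr1.
have y'1 t : `|N^-1 * y t| <= 1.
  by rewrite normrM gtr0_norm ?invr_gt0// ler_pdivrMl// mulr1.
have := GD _ _ cx' cy' x'1 y'1.
rewrite (functionalZ (bilinear_section hG cy' y'1))//.
rewrite (functionalZ (bilinear_section_r hG cx xM))//.
rewrite !normrM !normfV (gtr0_norm M1) (gtr0_norm N1) !ler_pdivrMl//.
by rewrite [D * M * N]mulrC mulrA [N * M]mulrC -mulrA mulrCA [D * M]mulrC.
Qed.

(** * Functionals on projective tensor products *)

Definition is_functional (R : pzRingType) (V : lmodType R) (phi : V -> R) :=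
  forall a u v, phi (a *: u + v) = a * phi u + phi v.

Section IsFunctional.
Variables (R : pzRingType) (V : lmodType R) (phi : V -> R).
Hypothesis hphi : is_functional phi.

Lemma is_functional0 : phi 0 = 0.
Proof.
have := hphi 1 0 0; rewrite scale1r addr0 mul1r => h.
by apply: (addrI (phi 0)); rewrite -h addr0.
Qed.

Lemma is_functionalD u v : phi (u + v) = phi u + phi v.
Proof. by have := hphi 1 u v; rewrite scale1r mul1r. Qed.

Lemma is_functionalZ a u : phi (a *: u) = a * phi u.
Proof. by have := hphi a u 0; rewrite !addr0 is_functional0 addr0. Qed.

Lemma is_functionalB u v : phi (u - v) = phi u - phi v.
Proof. by rewrite is_functionalD -scaleN1r is_functionalZ mulN1r. Qed.

Lemma is_functional_sum I (r : seq I) (F : I -> V) :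
  phi (\sum_(i <- r) F i) = \sum_(i <- r) phi (F i).
Proof.
elim: r => [|i r IH]; first by rewrite !big_nil is_functional0.
by rewrite !big_cons is_functionalD IH.
Qed.

End IsFunctional.

Section CompletionExtension.
Variables (R : realType) (V : lmodType R) (p : V -> R) (sp : is_seminorm p).
Variables (C : R) (phi : V -> R).
Hypotheses (C0 : 0 <= C) (hphi : is_functional phi).
Hypothesis phi_le : forall v, `|phi v| <= C * p v.

Lemma cvg_functional (u : cauchy_seq sp) : cvgn (phi \o u).
Proof.
have C1 : 0 < C + 1 by rewrite ltr_wpDl.
apply/cauchy_cvgP/cauchyP => e e0.
have [N h] := cauchy_seqP u (divr_gt0 e0 C1).
exists (phi (u N)); exists N => // n /= Nn; rewrite -ball_normE /=.
rewrite -(is_functionalB hphi); apply: le_lt_trans (phi_le _) _.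
apply: (@le_lt_trans _ _ ((C + 1) * p (u N - u n))).
  by rewrite ler_wpM2r ?(seminorm_ge0 sp)// lerDl.
by rewrite mulrC -ltr_pdivlMr//; apply: h.
Qed.

(** The value at the class of a Cauchy sequence is the limit of the values. *)
Lemma completion_functional : exists Phi : completion sp -> R,
  [/\ is_functional Phi, forall v, Phi (completion_embed sp v) = phi v &
      forall x, `|Phi x| <= C * `|x|].
Proof.
pose Phi (x : completion sp) := limn (phi \o repr x).
have PhiE (u : cauchy_seq sp) : Phi (quotmod_pi (null_seq (sp:=sp)) u) = limn (phi \o u).
  rewrite /Phi; set w := repr _.
  have /asboolP wu : w - u \in null_seq (sp:=sp) by exact: quotmod_repr.
  apply/eqP; rewrite -subr_eq0 -limB; try exact: cvg_functional.
  apply/eqP/cvg_lim => //; apply/norm_cvg0P.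
  have h : (fun n => C * p (w n - u n)) @ \oo --> 0.
    by rewrite -(mulr0 C); apply: cvgMr.
  apply: (squeeze_cvgr _ (cvg_cst 0) h); near=> n.
  rewrite normr_ge0 /=; have := phi_le (w n - u n).
  by rewrite (is_functionalB hphi).
exists Phi; split.
- move=> a x y; rewrite -[x]quotmod_reprK -[y]quotmod_reprK.
  rewrite -(linearP (quotmod_pi (null_seq (sp:=sp)))) !PhiE.
  apply/cvg_lim => //.
  rewrite (_ : _ \o _ = fun n => a * phi (repr x n) + phi (repr y n)); last first.
    by apply/funext => n; exact: hphi.
  by apply: cvgD; [apply: cvgMr|]; exact: cvg_functional.
- move=> v; rewrite PhiE; apply/cvg_lim => //.
  by rewrite (_ : _ \o _ = cst (phi v))//; exact: cvg_cst.
- move=> x; rewrite -[x]quotmod_reprK PhiE [in leRHS]/Num.norm /= completion_normE.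
  set u := repr x; have cu : `|phi (u n)| @[n --> \oo] --> `|limn (phi \o u)|.
    by apply: cvg_norm; exact: cvg_functional.
  have pu : C * p (u n) @[n --> \oo] --> C * limn (p \o u).
    by apply: cvgMr; exact: cvg_seminorm.
  rewrite -(cvg_lim _ cu)// -(cvg_lim _ pu)//; apply: ler_lim.
  + by apply/cvg_ex; eexists; exact: cu.
  + by apply/cvg_ex; eexists; exact: pu.
  + by near=> n; exact: phi_le.
Unshelve. all: by end_near. Qed.

End CompletionExtension.

Section FreeModule.
Variables (R : realType) (T : choiceType) (tau : T -> R).

Definition free_functional (r : malg T R) : R :=
  \sum_(k <- finmap.enum_fset (msupp r)) mcoeff k r * tau k.

Lemma free_functional_widen (d : {fset T}) (r : malg T R) :
  (msupp r `<=` d)%fset ->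
  free_functional r = \sum_(k <- finmap.enum_fset d) mcoeff k r * tau k.
Proof.
move=> rd; apply: big_fset_incl => // k _; rewrite -mcoeff_eq0 => /eqP ->.
by rewrite mul0r.
Qed.

Lemma free_functionalP : is_functional free_functional.
Proof.
move=> a r r'; pose d := (msupp (a *: r + r') `|` (msupp r `|` msupp r'))%fset.
rewrite (@free_functional_widen d (a *: r + r')) ?fsubsetUl//.
rewrite (@free_functional_widen d r); last first.
  by rewrite (fsubset_trans (fsubsetUl _ (msupp r')))// fsubsetUr.
rewrite (@free_functional_widen d r'); last first.
  by rewrite (fsubset_trans (fsubsetUr (msupp r) _))// fsubsetUr.
rewrite mulr_sumr -big_split; apply: eq_bigr => k _ /=.
by rewrite mcoeffD mcoeffZ mulrDl mulrA.
Qed.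

Lemma free_functional_gen k : free_functional (mkmalgU k 1) = tau k.
Proof.
rewrite (@free_functional_widen [fset k]%fset); last exact: msuppU_le.
by rewrite big_seq_fset1 mcoeffUU mul1r.
Qed.

End FreeModule.

Section TensorFunctionals.
Variables (R : realType) (X : normedModType R) (n : nat) (n_gt0 : (0 < n)%N).
Implicit Types (C : R) (x : {ffun 'I_n -> X}).

Definition is_multilinear (tau : {ffun 'I_n -> X} -> R) := forall x i a y z,
  tau (upd x i (a *: y + z)) = a * tau (upd x i y) + tau (upd x i z).

Lemma algtensor_functional tau : is_multilinear tau ->
  exists phi : algtensor X n -> R,
    is_functional phi /\ forall x, phi (pure_tensor x) = tau x.
Proof.
move=> htau; pose L := free_functional tau.
have hL : is_functional L := free_functionalP tau.
have L0 r : r \in submod_span (multilinear_relations (X := X) (n := n)) -> L r = 0.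
  move=> /asboolP /(_ [set r | L r = 0]); apply; split.
    split; first by apply/asboolP; exact: is_functional0.
    move=> a u v /asboolP /= Lu /asboolP /= Lv; apply/asboolP => /=.
    by rewrite hL Lu Lv mulr0 addr0.
  move=> _ [x [i [a [y [z ->]]]]] /=.
  by rewrite (is_functionalB hL) hL /L !free_functional_gen htau subrr.
pose phi (u : algtensor X n) := L (repr u).
have phiE r : phi (quotmod_pi (submod_span (multilinear_relations (n := n))) r) = L r.
  apply/eqP; rewrite -subr_eq0 -(is_functionalB hL); apply/eqP/L0.
  exact: quotmod_repr.
exists phi; split; last by move=> x; rewrite phiE /L free_functional_gen.
move=> a u v; rewrite -[u]quotmod_reprK -[v]quotmod_reprK.
by rewrite -(linearP (quotmod_pi (submod_span (multilinear_relations (n := n))))) !phiE hL.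
Qed.

Lemma le_projective_norm C (phi : algtensor X n -> R) : 0 <= C ->
  is_functional phi ->
  (forall x, `|phi (pure_tensor x)| <= C * \prod_(i < n) `|x i|) ->
  forall u, `|phi u| <= C * projective_norm u.
Proof.
move=> C0 hphi h u.
have le (s : seq {ffun 'I_n -> X}) : u = \sum_(x <- s) pure_tensor x ->
    `|phi u| <= C * \sum_(x <- s) \prod_(i < n) `|x i|.
  move=> ->; rewrite (is_functional_sum hphi) mulr_sumr.
  by apply: le_trans (ler_norm_sum _ _ _) _; apply: ler_sum.
have [s us] := algtensor_gen n_gt0 u.
have [C00|Cn0] := eqVneq C 0; first by have := le s us; rewrite C00 !mul0r.
have Cgt0 : 0 < C by rewrite lt_neqAle eq_sym Cn0.
rewrite mulrC -ler_pdivrMr//; apply: lb_le_inf; first by eexists; exists s.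
by move=> _ [s' us' <-]; rewrite ler_pdivrMr// mulrC; exact: le.
Qed.

Definition tensor x : projtensor X n n_gt0 := completion_embed _ (pure_tensor x).

Lemma tensorP x i a y z :
  tensor (upd x i (a *: y + z)) = a *: tensor (upd x i y) + tensor (upd x i z).
Proof. by rewrite /tensor pure_tensorP linearP. Qed.

Lemma tensor_norm_le x : `|tensor x| <= \prod_(i < n) `|x i|.
Proof.
rewrite /tensor norm_completion_embed; apply: ge_inf.
  by exists 0 => _ [s _ <-]; apply: sumr_ge0 => y _; apply: prodr_ge0.
by exists [:: x]; rewrite /= big_seq1.
Qed.

(** The universal property of the projective tensor product. The linear extension of
tau to the free module vanishes on the multilinear relations; its bound on
elementary tensors passes to the infimum over representations, and then to the
completion. *)
Lemma projtensor_functional C tau : 0 <= C -> is_multilinear tau ->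
  (forall x, `|tau x| <= C * \prod_(i < n) `|x i|) ->
  exists Phi : projtensor X n n_gt0 -> R,
    [/\ is_functional Phi, forall x, Phi (tensor x) = tau x &
        forall v, `|Phi v| <= C * `|v|].
Proof.
move=> C0 htau tauC; have [phi [hphi phiE]] := algtensor_functional htau.
have phiC x : `|phi (pure_tensor x)| <= C * \prod_(i < n) `|x i|.
  by rewrite phiE.
have [Phi [hPhi PhiE PhiC]] := completion_functional
  (projective_norm_seminorm X n_gt0) C0 hphi (le_projective_norm C0 hphi phiC).
by exists Phi; split=> // x; rewrite PhiE phiE.
Qed.

(** The norm of a functional is determined by the elementary tensors. The bound B only
serves to pass from the dense algebraic tensor product to the completion. *)
Lemma projtensor_functional_le B C (Phi : projtensor X n n_gt0 -> R) : 0 <= C ->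
  is_functional Phi -> (forall v, `|Phi v| <= B * `|v|) ->
  (forall x, `|Phi (tensor x)| <= C * \prod_(i < n) `|x i|) ->
  forall v, `|Phi v| <= C * `|v|.
Proof.
move=> C0 hPhi PhiB PhiC v.
pose phi u := Phi (completion_embed (projective_norm_seminorm X n_gt0) u).
have hphi : is_functional phi by move=> a u w; rewrite /phi linearP hPhi.
have phiC := le_projective_norm C0 hphi PhiC.
apply/ler_addgt0Pl => e e0.
have D0 : 0 < C + `|B| + 1 by rewrite ltr_wpDl// addr_ge0.
have [u vu] := completion_embed_dense v (divr_gt0 e0 D0).
set d := e / _ in vu; set w := completion_embed _ u in vu.
have wv : `|w| <= `|v| + d.
  rewrite -[w](subrK v) addrC; apply: le_trans (ler_normD _ _) _.
  by rewrite distrC lerD2l ltW.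
have -> : Phi v = Phi (v - w) + Phi w.
  by rewrite -(is_functionalD hPhi) subrK.
apply: le_trans (ler_normD _ _) _.
have h1 : `|Phi (v - w)| <= `|B| * d.
  apply: le_trans (PhiB _) _; apply: (@le_trans _ _ (`|B| * `|v - w|)).
    by rewrite ler_wpM2r// ler_norm.
  by rewrite ler_wpM2l// ltW.
have h2 : `|Phi w| <= C * (`|v| + d).
  have wu : projective_norm u = `|w| by rewrite /w norm_completion_embed.
  by apply: le_trans (phiC u) _; rewrite wu ler_wpM2l.
have h3 : (C + `|B| + 1) * d = e by rewrite /d mulrC divfK// gt_eqF.
have d0 : 0 < d by rewrite divr_gt0.
nra.
Qed.

End TensorFunctionals.

(** * The supremum norm, and lifts through a quotient *)

Section SupNorm.
Variables (R : realType) (K : topologicalType) (cK : compact [set: K]).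
Local Notation CK := (CK R cK).

(** The function 0 stands for the functions that are not continuous. *)
Definition to_CK (f : K -> R) : CK := insubd (0 : CK) f.

Lemma to_CKE f : continuous f -> to_CK f = f :> (K -> R).
Proof. by move=> cf; rewrite /to_CK insubdK//; apply/asboolP. Qed.

Lemma le_CK_norm (f : CK) t : `|f t| <= `|f|.
Proof.
apply: ub_le_sup; last by exists t.
have cnf : continuous (fun x => `|f x|).
  by move=> y; apply: cvg_norm; exact: contfun_continuous.
have [|c _ hc] := compact_EVT_max _ cK (continuous_subspaceT cnf).
  by exists t.
by exists `|f c| => _ [y _ <-]; apply: hc; rewrite inE.
Qed.

Lemma CK_norm_le (f : CK) M : 0 <= M -> (forall t, `|f t| <= M) -> `|f| <= M.
Proof.
move=> M0 fM; rewrite [leLHS]/Num.norm /= /sup_norm.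
have [[y Sy]|S0] := pselect (range (fun x => `|f x|) !=set0).
  by apply: ge_sup; [exists y|move=> _ [x _ <-]].
by rewrite sup_out// => -[/S0].
Qed.

Lemma CK_linearE (a : R) (f g : CK) t : (a *: f + g : CK) t = a * f t + g t.
Proof. by []. Qed.

Lemma to_CKP (a : R) f g : continuous f -> continuous g ->
  to_CK (fun t => a * f t + g t) = a *: to_CK f + to_CK g.
Proof.
move=> cf cg; apply/val_inj/funext => t.
by rewrite /= to_CKE ?CK_linearE ?to_CKE//; exact: continuous_linear.
Qed.

End SupNorm.

Section QuotientLifts.
Variables (R : realType) (U Y : normedModType R) (Z : submodClosed Y).
Hypothesis cZ : closed [set` Z].

Lemma linear_bound (V W : normedModType R) (f : {linear V -> W}) : continuous f ->
  exists2 M, 0 <= M & forall v, `|f v| <= M * `|v|.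
Proof.
move=> cf; have /linear_boundedP[M [_ hM]] := continuous_linear_bounded 0 (cf 0).
exists (`|M| + 1) => [|v]; first by rewrite addr_ge0.
by apply: hM; rewrite (le_lt_trans (ler_norm M))// ltrDl.
Qed.

(** An isomorphism with a quotient of Y is a bounded map from Y whose values have
bounded preimages; the summand 1 is there because the quotient norm is an infimum. *)
Lemma isomorphic_quotient_lift : isomorphic U (quotient_space cZ) ->
  exists (q : Y -> U) (C : R), [/\ 0 <= C, linear q,
    forall v, `|q v| <= C * `|v| &
    forall w, exists2 v, q v = w & `|v| <= C * `|w| + 1].
Proof.
move=> [f [g [cf cg fK gK]]].
have [M M0 fM] := linear_bound cf; have [M' M'0 gM] := linear_bound cg.
pose pi (v : Y) : quotient_space cZ := quotmod_pi Z v.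
exists (fun v => g (pi v)), (M + M'); split; first by rewrite addr_ge0.
- move=> a u v; rewrite /pi -linearP; congr (g _); exact: linearP.
- move=> v; apply: le_trans (gM _) _.
  apply: (@le_trans _ _ (M' * `|v|)); last by rewrite ler_wpM2r// lerDr.
  rewrite ler_wpM2l//; apply: ge_inf; last by exists v.
  by exists 0 => _ [y _ <-].
- move=> w; pose S := [set `|y| | y in [set y | quotmod_pi Z y = f w]].
  have hS : has_inf S.
    split; first by exists `|repr (f w)|, (repr (f w)) => //; exact: quotmod_reprK.
    by exists 0 => _ [y _ <-].
  have [_ [y yq <-] ye] := inf_adherent ltr01 hS.
  exists y; first by rewrite /pi yq fK.
  apply: le_trans (ltW ye) _; rewrite lerD2r -[inf S]/(`|f w|).
  by apply: le_trans (fM w) _; rewrite ler_wpM2r// lerDl.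
Qed.

End QuotientLifts.

(** * Bilinear forms from functionals on the 2-fold product *)

Section BilinearFormOfFunctional.
Variables (R : realType) (K : metricType R) (cK : compact [set: K]).
Local Notation CK := (CK R cK).
Local Notation E2 := (projtensor CK 2 isT).

Definition tensor2 (x y : K -> R) : E2 :=
  @tensor R CK 2 isT [ffun i : 'I_2 => if i == ord0 then to_CK cK x else to_CK cK y].

Lemma tensor2Pl (a : R) (x x' y : K -> R) : continuous x -> continuous x' ->
  tensor2 (fun t => a * x t + x' t) y = a *: tensor2 x y + tensor2 x' y.
Proof.
move=> cx cx'; have E z : [ffun i : 'I_2 => if i == ord0 then z else to_CK cK y] =
    upd [ffun=> to_CK cK y] ord0 z.
  by apply/ffunP => i; rewrite !ffunE.
by rewrite /tensor2 to_CKP// !E tensorP.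
Qed.

Lemma tensor2Pr (a : R) (x y y' : K -> R) : continuous y -> continuous y' ->
  tensor2 x (fun t => a * y t + y' t) = a *: tensor2 x y + tensor2 x y'.
Proof.
move=> cy cy'; have E z : [ffun i : 'I_2 => if i == ord0 then to_CK cK x else z] =
    upd [ffun=> to_CK cK x] ord_max z.
  by apply/ffunP => -[[|[|//]] i]; rewrite !ffunE.
by rewrite /tensor2 to_CKP// !E tensorP.
Qed.

Lemma to_CK_norm_le (x : K -> R) M : K -> continuous x -> (forall t, `|x t| <= M) ->
  `|to_CK cK x| <= M.
Proof.
move=> t0 cx xM; apply: CK_norm_le; first exact: le_trans (xM t0).
by move=> t; rewrite to_CKE.
Qed.

Lemma tensor2E (w : {ffun 'I_2 -> CK}) : @tensor R CK 2 isT w = tensor2 (w ord0) (w ord_max).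
Proof.
have valK (f : CK) : to_CK cK f = f.
  by apply/val_inj; rewrite /= to_CKE//; exact: contfun_continuous.
by congr tensor; apply/ffunP => -[[|[|//]] i]; rewrite ffunE /= valK; congr (w _);
  exact: val_inj.
Qed.

Lemma bounded_bilinear_tensor2 B (Psi : E2 -> R) : K -> 0 <= B ->
  is_functional Psi -> (forall v, `|Psi v| <= B * `|v|) ->
  bounded_bilinear B (fun x y => Psi (tensor2 x y)).
Proof.
move=> t0 B0 hPsi PsiB; split=> [a x x' y cx cx' cy|a x y y' cx cy cy'|x y M N cx cy xM yN].
- by rewrite tensor2Pl// hPsi.
- by rewrite tensor2Pr// hPsi.
apply: le_trans (PsiB _) _; rewrite -mulrA ler_wpM2l//.
apply: le_trans (tensor_norm_le _ _) _.
rewrite big_ord_recl big_ord1 !ffunE /= ler_pM//; exact: to_CK_norm_le.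
Qed.

(** A functional that is larger than delta at some v of norm 1 is larger than delta at
an elementary tensor of two functions in the unit ball. *)
Lemma functional_large_at_tensor B delta (Psi : E2 -> R) v : K -> 0 <= B ->
  is_functional Psi -> (forall v, `|Psi v| <= B * `|v|) ->
  0 <= delta -> delta * `|v| < `|Psi v| ->
  exists x y : K -> R, [/\ continuous x, continuous y,
    forall t, `|x t| <= 1, forall t, `|y t| <= 1 & delta < `|Psi (tensor2 x y)|].
Proof.
move=> t0 B0 hPsi PsiB delta0; rewrite ltNge => /negP; apply: contra_notP => none.
apply: (projtensor_functional_le delta0 hPsi PsiB) => w.
rewrite tensor2E big_ord_recl big_ord1 mulrA.
have -> : lift ord0 ord0 = ord_max :> 'I_2 by exact: val_inj.
have hG := bounded_bilinear_tensor2 t0 B0 hPsi PsiB.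
apply: (bilinear_ball_le hG) => //; try exact: contfun_continuous.
- move=> x y cx cy x1 y1; rewrite leNgt; apply/negP => h.
  by apply: none; exists x, y.
- exact: le_CK_norm.
- exact: le_CK_norm.
Qed.

End BilinearFormOfFunctional.

(** * Rademacher forms on the 3-fold product *)

Section RademacherForms.
Variables (R : realType) (K : metricType R) (cK : compact [set: K]).
Variables (e : nat -> K) (k : nat).
Hypothesis e_inj : injective e.
Local Notation CK := (CK R cK).
Local Notation F3 := (projtensor CK 3 isT).

(** The n-th Rademacher coefficient of f, for the system of signs carried by the first
2 ^ k points of the sequence e. *)
Definition rademacher_coef (n : 'I_k) (f : CK) : R :=
  mean (fun s : {ffun 'I_k -> bool} => f (e (enum_rank s)) * rademacher R s n).

Lemma rademacher_coefP n (a : R) f g :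
  rademacher_coef n (a *: f + g) = a * rademacher_coef n f + rademacher_coef n g.
Proof.
rewrite /rademacher_coef -meanZ -meanD; apply: eq_mean => s.
by rewrite CK_linearE mulrDl mulrA.
Qed.

Lemma rademacher_coef_le f g :
  \sum_n `|rademacher_coef n f * rademacher_coef n g| <= `|f| * `|g|.
Proof.
have sq h : \sum_n rademacher_coef n h ^+ 2 <= `|h| ^+ 2.
  apply: le_trans (bessel _) _; apply: mean_le => s.
  by rewrite -[leLHS]real_normK ?num_real// lerXn2r ?nnegrE// le_CK_norm.
exact: sum_norm_prod_le.
Qed.

Let i0 : 'I_3 := @Ordinal 3 0 isT.
Let i1 : 'I_3 := @Ordinal 3 1 isT.
Let i2 : 'I_3 := @Ordinal 3 2 isT.

Definition rademacher_form n t (w : {ffun 'I_3 -> CK}) : R :=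
  rademacher_coef n (w i0) * rademacher_coef n (w i1) * w i2 (e t).

Lemma rademacher_form_multilinear n t : is_multilinear (rademacher_form n t).
Proof.
move=> x [[|[|[|//]]] i] a y z; rewrite /rademacher_form !ffunE /=.
- by rewrite rademacher_coefP; ring.
- by rewrite rademacher_coefP; ring.
- transitivity (rademacher_coef n (x i0) * rademacher_coef n (x i1) *
    (a * y (e t) + z (e t))); [by []|ring].
Qed.

Lemma prod3 (w : {ffun 'I_3 -> CK}) :
  \prod_(i < 3) `|w i| = `|w i0| * `|w i1| * `|w i2|.
Proof.
rewrite !big_ord_recl big_ord0 mulr1 mulrA.
by congr (`|w _| * `|w _| * `|w _|); exact: val_inj.
Qed.

Lemma rademacher_form_le n t w : `|rademacher_form n t w| <= 1 * \prod_(i < 3) `|w i|.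
Proof.
rewrite mul1r prod3 normrM ler_pM ?le_CK_norm//.
apply: le_trans (rademacher_coef_le (w i0) (w i1)).
by rewrite (bigD1 n)//= lerDl sumr_ge0.
Qed.

(** Bessel's inequality bounds the sum over n of the products of two coefficients by
the product of the norms, independently of k and of the signs. *)
Lemma rademacher_form_signs (t t' : 'I_k -> nat) s w :
  `|\sum_n rademacher R s n *
     (rademacher_form n (t n) w - rademacher_form n (t' n) w)| <=
  2 * \prod_(i < 3) `|w i|.
Proof.
rewrite prod3 mulrCA.
apply: le_trans (ler_norm_sum _ _ _) _.
have W0 : 0 <= 2 * `|w i2| by rewrite mulr_ge0.
apply: le_trans (ler_wpM2r W0 (rademacher_coef_le (w i0) (w i1))).
rewrite mulr_suml; apply: ler_sum => n _.
rewrite normrM rademacher_norm mul1r -mulrBr normrM ler_wpM2l//.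
apply: le_trans (ler_normB _ _) _.
by rewrite mulr_natl mulr2n lerD// le_CK_norm.
Qed.

(** Take for the first two factors a continuous function with the values of the n-th
Rademacher function at the points, and for the third one a function which is 1 at
e t and 0 at e t'. *)
Lemma rademacher_form_separated n t t' : t != t' -> exists w : {ffun 'I_3 -> CK},
  \prod_(i < 3) `|w i| <= 1 /\ rademacher_form n t w - rademacher_form n t' w = 1.
Proof.
move=> tt'; pose T := {: {ffun 'I_k -> bool}}.
have T0 : (0 < #|T|)%N by rewrite card_ffun expn_gt0 card_bool.
pose sg (i : nat) : R := rademacher R (enum_val (insubd (Ordinal T0) i)) n.
have sg1 i : `|sg i| <= 1 by rewrite rademacher_norm.
have [r [cr r1 rE]] := @tents_interpolate R K e #|T| sg e_inj sg1.
have [|z [cz z1 zE]] := @tents_interpolate R K e (maxn t t').+1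
    (fun i => (i == t)%:R) e_inj.
  by move=> i; case: eqP; rewrite ?normr1 ?normr0.
exists [ffun i : 'I_3 => if i == i2 then to_CK cK z else to_CK cK r].
have r1' : `|to_CK cK r| <= 1 by exact: to_CK_norm_le (e 0%N) cr r1.
have z1' : `|to_CK cK z| <= 1 by exact: to_CK_norm_le (e 0%N) cz z1.
have coef1 : rademacher_coef n (to_CK cK r) = 1.
  rewrite /rademacher_coef -[RHS](mean_cst k); apply: eq_mean => s.
  rewrite to_CKE// rE ?ltn_ord// /sg.
  by rewrite (_ : insubd _ _ = enum_rank s) ?enum_rankK ?rademacherM// valKd.
split.
  rewrite prod3 !ffunE /= -[leRHS]mulr1 ler_pM// ?mulr_ge0//.
  by rewrite -[leRHS]mulr1 ler_pM.
rewrite /rademacher_form !ffunE /= coef1 to_CKE// !mul1r.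
rewrite !zE ?ltnS ?leq_maxl ?leq_maxr// eqxx eq_sym (negPf tt').
by rewrite subr0.
Qed.

End RademacherForms.

(** * The contradiction *)

Section NoLift.
Variables (R : realType) (K : metricType R) (cK : compact [set: K]).
Variable e : nat -> K.
Hypotheses (e_inj : injective e) (e_surj : forall t, exists i, e i = t).
Local Notation CK := (CK R cK).
Local Notation E2 := (projtensor CK 2 isT).
Local Notation F3 := (projtensor CK 3 isT).
Local Notation tensor3 := (@tensor R CK 3 isT).
Variables (q : E2 -> F3) (C : R).
Hypotheses (C0 : 0 <= C) (q_linear : linear q).
Hypothesis q_le : forall v, `|q v| <= C * `|v|.
Hypothesis q_lift : forall w, exists2 v, q v = w & `|v| <= C * `|w| + 1.

Lemma comp_functional (Psi : F3 -> R) : is_functional Psi -> is_functional (Psi \o q).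
Proof. by move=> hPsi a u v; rewrite /= q_linear hPsi. Qed.

Lemma comp_functional_le B (Psi : F3 -> R) : 0 <= B ->
  (forall v, `|Psi v| <= B * `|v|) -> forall v, `|(Psi \o q) v| <= B * C * `|v|.
Proof.
move=> B0 PsiB v; apply: le_trans (PsiB _) _.
by rewrite -mulrA ler_wpM2l.
Qed.

(** [signed_family_bound] applied to the matrices of the forms obtained from the
Rademacher forms through q. The separation constant comes from the lifts: the
elementary tensor at which two Rademacher forms differ by 1 has a preimage of norm
at most C + 1. *)
Lemma sqrt_dimension_bound k :
  k%:R * ((4 * (C + 1))^-1 / 2) <= 4 * Num.sqrt k%:R * (2 * C).
Proof.
have C1 : C + 1 != 0 by rewrite gt_eqF// ltr_wpDl.
set delta := (4 * (C + 1))^-1.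
have delta0 : 0 < delta by rewrite invr_gt0 mulr_gt0// ltr_wpDl.
have /choice[Phi hPhi] (nt : 'I_k * nat) : exists Phi : F3 -> R,
    [/\ is_functional Phi,
        forall w, Phi (tensor3 w) = rademacher_form e nt.1 nt.2 w &
        forall v, `|Phi v| <= 1 * `|v|].
  apply: projtensor_functional; first exact: ler01.
    exact: rademacher_form_multilinear.
  exact: rademacher_form_le.
pose G n t x y := Phi (n, t) (q (tensor2 cK x y)).
have t0 : K := e 0%N.
have hG n t : bounded_bilinear C (G n t).
  have [h1 _ h2] := hPhi (n, t).
  have := comp_functional_le ler01 h2; rewrite mul1r => h.
  exact: (bounded_bilinear_tensor2 t0 C0 (comp_functional h1) h).
pose H n t t' x y := -1 * G n t' x y + G n t x y.
have hH n t t' : bounded_bilinear (`|-1| * C + C) (H n t t').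
  exact: bounded_bilinearP.
have matH n t t' i j : bilinear_matrix e (H n t t') i j =
    bilinear_matrix e (G n t) i j - bilinear_matrix e (G n t') i j.
  by rewrite (bilinear_matrixP e cK _ _ _ (hG n t') (hG n t)) mulN1r addrC.
apply: (@signed_family_bound R k (fun n t => bilinear_matrix e (G n t)) C (2 * C) delta) => //.
- by move=> n t i j; exact: bilinear_matrix_le.
- move=> n t t' tt'.
  have [w [w1 hw]] := @rademacher_form_separated R K cK e k e_inj n t t' tt'.
  have [v qv vC] := q_lift (tensor3 w).
  pose Psi v := Phi (n, t) v - Phi (n, t') v.
  have [h1 e1 b1] := hPhi (n, t); have [h2 e2 b2] := hPhi (n, t').
  have hPsi : is_functional Psi by move=> a u u'; rewrite /Psi h1 h2; ring.
  have PsiB u : `|Psi u| <= 2 * `|u|.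
    apply: le_trans (ler_normB _ _) _.
    by have := b1 u; have := b2 u; lra.
  have Psiv : (Psi \o q) v = 1 by rewrite /= qv /Psi e1 e2.
  have tw : `|tensor3 w| <= 1 by exact: le_trans (tensor_norm_le _ _) w1.
  have vC1 : `|v| <= C + 1.
    by apply: le_trans vC _; rewrite lerD2r -[leRHS]mulr1 ler_wpM2l.
  have lt1 : 2 * delta * `|v| < `|(Psi \o q) v|.
    rewrite Psiv normr1 (@le_lt_trans _ _ (2 * delta * (C + 1)))//.
      by rewrite ler_wpM2l// mulr_ge0// ltW.
    have -> : 2 * delta * (C + 1) = 2^-1 by rewrite /delta; field.
    by rewrite invf_lt1// ltr1n.
  have [|||x [y [cx cy x1 y1 hxy]]] := functional_large_at_tensor t0 _
    (comp_functional hPsi) (comp_functional_le _ PsiB) _ lt1.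
  + by rewrite mulr_ge0.
  + by [].
  + by rewrite mulr_ge0// ltW.
  have [N [N' approx]] := bilinear_matrix_approx cK e_inj e_surj (hH n t t')
    cx cy x1 y1 delta0.
  exists N, N', (x \o e), (y \o e); split=> [i|j|]; [exact: x1|exact: y1|].
  under eq_bigr do under eq_bigr do rewrite -matH.
  set S := \sum_(i < N) _ in approx *.
  have hxy' : 2 * delta < `|H n t t' x y| by rewrite /H mulN1r addrC.
  have := ler_normD (H n t t' x y - S) S; rewrite subrK; lra.
- move=> t t' s L u v u1 v1.
  pose Xi w := \sum_n rademacher R s n * (Phi (n, t n) w - Phi (n, t' n) w).
  have hXi : is_functional Xi.
    move=> a w w'; rewrite /Xi mulr_sumr -big_split; apply: eq_bigr => n _ /=.
    by have [h1 _ _] := hPhi (n, t n); have [h2 _ _] := hPhi (n, t' n);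
      rewrite h1 h2; ring.
  have XiB w : `|Xi w| <= k%:R * 2 * `|w|.
    apply: le_trans (ler_norm_sum _ _ _) _.
    apply: (@le_trans _ _ (\sum_(n < k) 2 * `|w|)); last first.
      by rewrite sumr_const card_ord -[_ *+ k]mulr_natl mulrA.
    apply: ler_sum => n _; rewrite normrM rademacher_norm mul1r.
    apply: le_trans (ler_normB _ _) _.
    have [_ _ /(_ w) b1] := hPhi (n, t n); have [_ _ /(_ w) b2] := hPhi (n, t' n).
    by lra.
  have Xi2 w : `|Xi w| <= 2 * `|w|.
    apply: (projtensor_functional_le _ hXi XiB) => // x.
    rewrite /Xi; have -> : \sum_n rademacher R s n *
        (Phi (n, t n) (tensor3 x) - Phi (n, t' n) (tensor3 x)) =
      \sum_n rademacher R s n *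
        (rademacher_form e n (t n) x - rademacher_form e n (t' n) x).
      by apply: eq_bigr => n _; have [_ -> _] := hPhi (n, t n);
        have [_ -> _] := hPhi (n, t' n).
    exact: rademacher_form_signs.
  have two0 : 0 <= 2 :> R by [].
  have hB := bounded_bilinear_tensor2 t0 (mulr_ge0 two0 C0) (comp_functional hXi)
    (comp_functional_le two0 Xi2).
  have := bilinear_matrix_form_le cK e_inj L L hB u1 v1.
  have -> : (fun x y => (Xi \o q) (tensor2 cK x y)) =
      (fun x y => \sum_n rademacher R s n * H n (t n) (t' n) x y).
    apply/funext => x; apply/funext => y; apply: eq_bigr => n _.
    by rewrite /H mulN1r addrC.
  move=> /ler_normlW; congr (_ <= _); apply: eq_bigr => i _; apply: eq_bigr => j _.
  rewrite (bilinear_matrix_sum e cK _ _ _ _ (fun n => hH n (t n) (t' n))).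
  congr (_ * _ * _); apply: eq_bigr => n _; rewrite matH mulrC//.
Qed.

(** The bound of [sqrt_dimension_bound] fails as soon as sqrt k exceeds 64 C (C + 1). *)
Lemma no_bounded_lift : False.
Proof.
pose M := 64 * C * (C + 1).
have M0 : 0 <= M by rewrite !mulr_ge0// addr_ge0.
have C1 : C + 1 != 0 by rewrite gt_eqF// ltr_wpDl.
pose k := (Num.truncn (M ^+ 2)).+1.
have kM : M ^+ 2 < k%:R := truncnS_gt _.
have := sqrt_dimension_bound k; set s := Num.sqrt _.
have s2 : s ^+ 2 = k%:R by rewrite sqr_sqrtr.
have s0 : 0 < s by rewrite sqrtr_gt0 ltr0n.
rewrite -s2 (_ : s ^+ 2 * _ = s * (s / (8 * (C + 1)))); last by field.
rewrite (_ : 4 * s * (2 * C) = s * (8 * C)); last by ring.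
rewrite ler_pM2l// ler_pdivrMr; last by rewrite mulr_gt0// ltr_wpDl.
rewrite (_ : 8 * C * (8 * (C + 1)) = M); last by rewrite /M; ring.
rewrite leNgt => /negP; apply.
by rewrite -(@ltr_pXn2r _ 2) ?nnegrE ?s2// ltW.
Qed.

End NoLift.

Theorem mainTheorem2 (R : realType) (K : metricType R)
    (cK : compact [set: K]) (K_countable : countable [set: K])
    (K_infinite : infinite_set [set: K]) :
  forall (Z : submodClosed (projtensor (CK R cK) 2 isT))
         (cZ : closed [set` Z]),
    ~ isomorphic (projtensor (CK R cK) 3 isT) (quotient_space cZ).
Proof.
move=> Z cZ iso.
have [f [_ f_inj f_surj]] : exists f : K -> nat, set_bij [set: K] [set: nat] f.
  by apply/card_set_bijP; exact: eq_card_nat.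
have /choice[e fe] (i : nat) : exists t, f t = i.
  by have [t _ <-] := f_surj i I; exists t.
have [q [C [C0 q_linear q_le q_lift]]] := isomorphic_quotient_lift iso.
apply: (@no_bounded_lift R K cK e _ _ q C) => //; first exact: can_inj fe.
by move=> t; exists (f t); apply: f_inj; rewrite ?inE ?fe.
Qed.
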